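(* Let $p,q\in[0,1)$ with $p+q\le 1$. If $p>0$ or $q>0$, then the probabilistic cellular automaton $A_{p,q}$ is ergodic, and the probability of a draw is zero for the percolation game on $\mathbb{Z}^2$ with parameters $p,q$.
   Context: **The PCA $A_{p,q}$.** Given a configuration $\eta_t\in\{0,1\}^{\mathbb{Z}}$, the configuration $\eta_{t+1}$ is obtained by updating all sites $n\in\mathbb{Z}$ simultaneously and (conditionally on $\eta_t$) independently: if $\eta_t(n-1)=\eta_t(n)=0$, then $\eta_{t+1}(n)$ equals $0$ with probability $p$ and $1$ with probability $1-p$; otherwise $\eta_{t+1}(n)$ equals $0$ with probability $1-q$ and $1$ with probability $q$. $A_{p,q}$ is regarded as an operator on probability distributions on $\{0,1\}^{\mathbb{Z}}$: if $\mu$ is the law of $\eta_t$ then $A_{p,q}\mu$ is the law of $\eta_{t+1}$. A distribution $\mu$ is stationary if $A_{p,q}\mu=\mu$. The PCA is *ergodic* if it has a unique stationary distribution and, from any initial distribution, its iterates converge to that stationary distribution (weak convergence with respect to the product topology). **The percolation game on $\mathbb{Z}^2$.** Each site of $\mathbb{Z}^2$ is independently a *trap* with probability $p$, a *target* with probability $q$, and *open* with probability $1-p-q$. A token starts at the origin. Two players move alternately; a move takes the token from its current site $x$ to $x+(1,0)$ or $x+(0,1)$. A player who moves the token to a trap loses immediately; a player who moves the token to a target wins immediately; otherwise the game continues with the other player's turn. Both players know the whole configuration of traps, targets and open sites at all times. A strategy for a player is a map assigning a legal move, where one exists, to each vertex; a winning strategy is one that results in a win for that player (in finitely many moves) whatever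 strategy the other player uses. The game is a *draw* if neither player has a winning strategy. (By convention, if the starting site is a trap the game from it is regarded as a win for the first player, and if it is a target as a loss for the first player; so it is not a draw in these cases.) *)

(* Defs.v *)
From HB Require Import structures.
From mathcomp Require Import all_boot all_order all_algebra.
From mathcomp Require Import all_classical all_reals all_analysis.
Import Order.TTheory GRing.Theory Num.Theory.
Import numFieldNormedType.Exports.

Set Implicit Arguments.
Unset Strict Implicit.
Unset Printing Implicit Defensive.

Local Open Scope classical_set_scope.
Local Open Scope ring_scope.

(* {0,1}^Z, with true standing for 1; it carries the product topology of the
   discrete topologies and the product sigma-algebra. *)
Definition config : Type := {ptws int -> bool}.

HB.instance Definition _ := Pointed.copy config (int -> bool).
HB.instance Definition _ := Topological.copy config {ptws int -> bool}.

Definition coordinate_events : set (set config) :=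
  [set B | exists (n : int) (b : bool), B = [set eta | eta n = b]].

HB.instance Definition _ :=
  Measurable.copy config (g_sigma_algebraType coordinate_events).

Section pca.
Variable R : realType.
Implicit Types (p q : R) (mu nu : probability config R).

(* Probability that the new state of n is c, where a and b are the current
   states of n - 1 and n. *)
Definition pca_rate p q (a b c : bool) : R :=
  if ~~ a && ~~ b then (if c then 1 - p else p) else (if c then q else 1 - q).

(* nu is the law of the configuration one step after a configuration of law
   mu. Given the current configuration the new states are independent, which
   fixes the nu-probability of every cylinder, hence nu. *)
Definition pca_law p q mu nu : Prop :=
  forall (s : seq int) (c : int -> bool), uniq s ->
    nu [set eta | forall n, n \in s -> eta n = c n] =
    (\int[mu]_eta
       (\prod_(n <- s) pca_rate p q (eta (n - 1)) (eta n) (c n))%:E)%E.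

(* A_{p,q} mu. For p, q in [0,1] a law satisfying pca_law p q mu exists by
   Kolmogorov's extension theorem, so that xget does choose such a law; the
   default value mu is irrelevant. *)
Definition pca p q mu : probability config R :=
  xget mu [set nu | pca_law p q mu nu].

(* A term of type probability config R also assigns values, without meaning,
   to non-measurable sets; equality of distributions must ignore them. *)
Definition same_law mu nu : Prop :=
  forall B : set config, measurable B -> mu B = nu B.

Definition weakly_converges (mu_ : nat -> probability config R) mu : Prop :=
  forall f : config -> R,
    continuous f -> (exists M : R, forall eta, `|f eta| <= M) ->
    (\int[mu_ t]_eta (f eta)%:E)%E @[t --> \oo] --> (\int[mu]_eta (f eta)%:E)%E.

Definition stationary (A : probability config R -> probability config R) mu :=
  same_law (A mu) mu.

Definition ergodic (A : probability config R -> probability config R) : Prop :=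
  exists mu, [/\ stationary A mu,
    forall nu, stationary A nu -> same_law nu mu &
    forall nu, weakly_converges (fun t => iter t A nu) mu].

End pca.

Inductive site := Trap | Target | Open.

Definition vertex : Type := (int * int)%type.

Definition legal_move (x y : vertex) : Prop :=
  y = (x.1 + 1, x.2) \/ y = (x.1, x.2 + 1).

Definition strategy (s : vertex -> vertex) : Prop :=
  forall x, legal_move x (s x).

(* Vertex of the token after n moves from x; s1 is used by the player who moves
   first, s2 by the other one. *)
Fixpoint token (s1 s2 : vertex -> vertex) (x : vertex) (n : nat) : vertex :=
  if n is m.+1 then
    let y := token s1 s2 x m in if odd m then s2 y else s1 y
  else x.

(* The game stops at the least n such that token s1 s2 x n is not open. If n is
   positive, the n-th move is due to the first player iff n is odd. For n = 0
   the formulas give the convention for a starting vertex that is not open: a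
   trap is a win, and a target a loss, of the first player. *)
Definition first_player_wins (w : vertex -> site) (x : vertex)
    (s1 s2 : vertex -> vertex) : Prop :=
  exists n : nat, (forall k, (k < n)%N -> w (token s1 s2 x k) = Open) /\
    w (token s1 s2 x n) = if odd n then Target else Trap.

Definition second_player_wins (w : vertex -> site) (x : vertex)
    (s1 s2 : vertex -> vertex) : Prop :=
  exists n : nat, (forall k, (k < n)%N -> w (token s1 s2 x k) = Open) /\
    w (token s1 s2 x n) = if odd n then Trap else Target.

Definition first_player_strategy_wins (w : vertex -> site) (x : vertex) : Prop :=
  exists2 s1, strategy s1 &
    forall s2, strategy s2 -> first_player_wins w x s1 s2.

Definition second_player_strategy_wins (w : vertex -> site) (x : vertex) : Prop :=
  exists2 s2, strategy s2 &
    forall s1, strategy s1 -> second_player_wins w x s1 s2.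

Definition draw (w : vertex -> site) : Prop :=
  ~ first_player_strategy_wins w (0, 0) /\
  ~ second_player_strategy_wins w (0, 0).

Definition site_prob (R : realType) (p q : R) (c : site) : R :=
  match c with Trap => p | Target => q | Open => 1 - p - q end.

Record percolation_field (R : realType) (p q : R) (d : measure_display)
    (Omega : measurableType d) (P : probability Omega R)
    (X : vertex -> Omega -> site) : Prop := {
  field_measurable : forall x c, measurable [set w | X x w = c];
  field_law : forall x c, P [set w | X x w = c] = (site_prob p q c)%:E;
  field_independent : forall (s : seq vertex) (C : vertex -> set site), uniq s ->
    P [set w | forall x, x \in s -> C x (X x w)] =
    (\prod_(x <- s) P [set w | C x (X x w)])%E }.

(* Main.v *)
Require Import Defs.
From HB Require Import structures.
From mathcomp Require Import all_boot all_order all_algebra.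
From mathcomp Require Import all_classical all_reals all_analysis.
From mathcomp Require Import measurable_realfun.
From mathcomp Require Import ring lra zify.
Import Order.TTheory GRing.Theory Num.Theory.
Import numFieldNormedType.Exports.

Set Implicit Arguments.
Unset Strict Implicit.
Unset Printing Implicit Defensive.

Local Open Scope classical_set_scope.
Local Open Scope ring_scope.

(* Enlarge the alphabet of the automaton by a third symbol "?" (unknown): label
   each site trap, target or open, and let an open site stay "?" as long as its
   two inputs do not determine the new state. Started from all "?", this
   envelope automaton dominates the difference between any two copies of the
   automaton driven by the same labels, and after t steps its state at one site
   is the value of the game truncated at depth t. So ergodicity and the absence
   of draws both follow once the density of "?" tends to 0.

   Write x, A, B, z for the probabilities of the patterns ?, ?0, ?1, ?01 at time
   t, and r = 1 - p - q. Translation and reflection invariance give linear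
   recurrences for x, A, B, z with a few further pattern probabilities as source
   terms, and a suitable linear combination of x, A, B, z decreases by at least
   kappa * x at each step, with kappa > 0. Being bounded, it forces the sum of
   the densities x to be finite, and x is nonincreasing, so x = O(1/t). *)

(** * The envelope automaton *)

(* The unknown symbol is None; on known states this is the rule of A_{p,q}
   driven by a label. In the game, Some false, Some true and None mean that the
   player to move wins, loses, or cannot tell yet. *)
Definition update (c : site) (a b : option bool) : option bool :=
  match c with
  | Trap => Some false
  | Target => Some true
  | Open =>
    if (a == Some true) || (b == Some true) then Some false
    else if (a == Some false) && (b == Some false) then Some true else None
  end.

Fixpoint step (l : seq site) (v : seq (option bool)) : seq (option bool) :=
  match l, v with
  | c :: l', a :: ((b :: _) as v') => update c a b :: step l' v'
  | _, _ => [::]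
  end.

(* The word u is obtained from v by forgetting the states of some sites. *)
Fixpoint refines (u v : seq (option bool)) : bool :=
  match u, v with
  | [::], [::] => true
  | a :: u', b :: v' => ((a == None) || (a == b)) && refines u' v'
  | _, _ => false
  end.

Lemma refines_size u v : refines u v -> size u = size v.
Proof. by elim: u v => [|a u IH] [|b v] //= /andP[_ /IH ->]. Qed.

Lemma refines_nseq v : refines (nseq (size v) None) v.
Proof. by elim: v. Qed.

Lemma refines_determined u v : refines u v -> None \notin u -> u = v.
Proof.
elim: u v => [|a u IH] [|b v] //= /andP[ab /IH uv].
rewrite inE negb_or eq_sym => /andP[aN /uv ->]; move: ab.
by rewrite (negbTE aN) => /eqP ->.
Qed.

(** [update] returns a known state only if every completion of its unknown inputs gives that state,
    so forgetting inputs can only forget outputs. *)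
Lemma refines_step l u v : refines u v -> refines (step l u) (step l v).
Proof.
elim: l u v => [|c l IH] [|a [|b u]] [|a' [|b' v]] //=.
- by rewrite andbF.
- by rewrite andbF.
- case/andP=> aa' /andP[bb' uv]; rewrite IH /= ?bb' // andbT.
  by move: aa' bb' {uv IH}; case: c a a' b b' => [] [[]|] [[]|] [[]|] [[]|].
Qed.

Lemma behead_step l v : behead (step l v) = step (behead l) (behead v).
Proof. by case: l v => [|c l] [|a [|b v]] //=; case: l. Qed.

Lemma size_step l v : size (step l v) = minn (size l) (size v).-1.
Proof.
elim: l v => [|c l IH] [|a [|b v]] //=; rewrite ?minn0 ?min0n //.
by rewrite IH /= minnSS.
Qed.

Lemma step_rcons l c v a b : size l = size v ->
  step (rcons l c) (rcons (rcons v a) b) =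
  rcons (step l (rcons v a)) (update c a b).
Proof.
elim: l v => [|d l IH] [|e v] //= [lv].
by move: (IH v lv); case: v {IH lv} => [|f v] /= ->.
Qed.

Lemma update_sym c a b : update c a b = update c b a.
Proof. by case: c a b => [] [[]|] [[]|]. Qed.

Lemma step_rev l v : size v = (size l).+1 -> step (rev l) (rev v) = rev (step l
  v).
Proof.
elim: l v => [|c l IH] [|a [|b v]] //= [] lv.
rewrite !rev_cons step_rcons ?size_rev; last by case: lv.
by rewrite update_sym -rev_cons IH //= lv.
Qed.

Section envelope.
Variables (R : realType) (p q : R).
Hypotheses (p_ge0 : 0 <= p) (q_ge0 : 0 <= q) (pq_le1 : p + q <= 1).

Local Notation r := (1 - p - q).

Let r_ge0 : 0 <= r. Proof. by move: pq_le1; lra. Qed.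

(** Expectation over n independent labels, as a finite recursion, so that coupling arguments become
    inductions on words. *)
Fixpoint mean n (F : seq site -> R) : R :=
  if n is n'.+1 then
    p * mean n' (fun l => F (Trap :: l)) + q * mean n' (fun l =>
      F (Target :: l))
    + r * mean n' (fun l => F (Open :: l))
  else F [::].

Lemma meanS n F : mean n.+1 F = p * mean n (fun l => F (Trap :: l)) +
  q * mean n (fun l => F (Target :: l)) + r * mean n (fun l => F (Open :: l)).
Proof. by []. Qed.

Lemma eq_mean n F G : (forall l, size l = n -> F l = G l) -> mean n F = mean n
  G.
Proof.
elim: n F G => [|n IH] F G FG /=; first exact: FG.
by congr (_ * _ + _ * _ + _ * _); apply: IH => l ln; apply: FG; rewrite /= ln.
Qed.

Lemma mean_linear n F G (a b : R) :
  mean n (fun l => a * F l + b * G l) = a * mean n F + b * mean n G.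
Proof. by elim: n F G => [|n IH] F G //=; rewrite !IH; ring. Qed.

Lemma mean_cst n a : mean n (fun=> a) = a.
Proof. by elim: n => //= n ->; ring. Qed.

Lemma le_mean n F G : (forall l, size l = n -> F l <= G l) ->
  mean n F <= mean n G.
Proof.
elim: n F G => [|n IH] F G FG /=; first exact: FG.
by rewrite !lerD // ler_wpM2l //; apply: IH => l ln; apply: FG; rewrite /= ln.
Qed.

Lemma mean_sub n F G : mean n (fun l => F l - G l) = mean n F - mean n G.
Proof. by elim: n F G => [|n IH] F G //=; rewrite !IH; ring. Qed.

Lemma norm_mean_le n F G (a : R) : (forall l, `|F l| <= a * G l) ->
  `|mean n F| <= a * mean n G.
Proof.
elim: n F G => [|n IH] F G FG; first exact: FG.
have := IH _ _ (fun l => FG (Open :: l)); have := IH _ _ (fun l =>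
  FG (Target :: l)).
have := IH _ _ (fun l => FG (Trap :: l)).
move=> /(ler_wpM2l p_ge0) hp /(ler_wpM2l q_ge0) hq /(ler_wpM2l r_ge0) ho /=.
apply: (le_trans (ler_normD _ _)); apply: (le_trans (lerD (ler_normD _ _) (lexx
  _))).
rewrite !normrM (ger0_norm p_ge0) (ger0_norm q_ge0) (ger0_norm r_ge0).
by lra.
Qed.

Lemma mean_rcons n F : mean n.+1 F =
  p * mean n (fun l => F (rcons l Trap)) + q * mean n (fun l =>
    F (rcons l Target))
    + r * mean n (fun l => F (rcons l Open)).
Proof.
elim: n F => [//|n IH] F.
by rewrite [LHS]meanS 3![in LHS]IH !meanS; ring.
Qed.

Lemma mean_rev n F : mean n (fun l => F (rev l)) = mean n F.
Proof.
elim: n F => [//|n IH] F; rewrite mean_rcons /=.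
by congr (_ * _ + _ * _ + _ * _);
  rewrite -[RHS]IH; apply: eq_mean => l _; rewrite rev_rcons.
Qed.

(* Dual action of one step on functions of words; a step shortens words by 1. *)
Definition expect (f : seq (option bool) -> R) (v : seq (option bool)) : R :=
  mean (size v).-1 (fun l => f (step l v)).

Lemma expect_linear f g (a b : R) v :
  expect (fun w => a * f w + b * g w) v = a * expect f v + b * expect g v.
Proof. exact: mean_linear. Qed.

Lemma iter_expect_linear t f g (a b : R) v :
  iter t expect (fun w => a * f w + b * g w) v =
  a * iter t expect f v + b * iter t expect g v.
Proof.
elim: t v => [//|t IH] v; rewrite !iterS -expect_linear.
by congr expect; apply/funext.
Qed.

Lemma iter_expect_cst t a v : iter t expect (fun=> a) v = a.
Proof.
elim: t v => [//|t IH] v; rewrite iterS -[RHS](mean_cst (size v).-1).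
by apply: eq_mean => l _; exact: IH.
Qed.

Lemma le_iter_expect t f g v : (forall w, f w <= g w) ->
  iter t expect f v <= iter t expect g v.
Proof. by move=> fg; elim: t v => [|t IH] v; [exact: fg | apply: le_mean => l _;
  exact: IH]. Qed.

Lemma eq_iter_expect t n f g v : (forall w, size w = n -> f w = g w) ->
  size v = (n + t)%N -> iter t expect f v = iter t expect g v.
Proof.
move=> fg; elim: t v => [|t IH] v; first by rewrite addn0; exact: fg.
move=> vn; apply: eq_mean => l ln; apply: IH.
by rewrite size_step ln minnn vn addnS.
Qed.

(** Translation invariance: the tail of the window never reads the first site, and the label of the
    dropped site averages out since p + q + r = 1. *)
Lemma iter_expect_behead t f v :
  iter t expect (fun w => f (behead w)) v = iter t expect f (behead v).
Proof.
suff -> : iter t expect (fun w => f (behead w)) = iter t expect f \o behead by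
  [].
elim: t => [//|t IH]; rewrite iterS IH; apply/funext => w /=.
rewrite /expect; case: w => [//|a w] /=.
transitivity (mean (size w) (fun l => iter t expect f (step (behead l) w))).
  by apply: eq_mean => l _ /=; rewrite behead_step.
by case: w => [//|b w]; rewrite /= -!mulrDl (_ : p + q + r = 1) ?mul1r //; ring.
Qed.

Lemma iter_expect_rev t f v :
  iter t expect (fun w => f (rev w)) v = iter t expect f (rev v).
Proof.
suff -> : iter t expect (fun w => f (rev w)) = iter t expect f \o rev by [].
elim: t => [//|t IH]; rewrite iterS IH; apply/funext => w /=.
rewrite /expect size_rev -mean_rev; case: w => [//|a w] /=.
by apply: eq_mean => l lw /=; rewrite -step_rev ?revK // size_rev lw.
Qed.

Definition has_unknown (w : seq (option bool)) : R := (None \in w)%:R.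

(* Drive u and v by the same labels: they can end up different only where the
   image of u still contains an unknown state. *)
Lemma iter_expect_refines t f M u v : (forall w, `|f w| <= M) -> refines u v ->
  `|iter t expect f v - iter t expect f u| <= 2 * M * iter t expect has_unknown
    u.
Proof.
move=> fM; elim: t u v => [|t IH] u v uv.
  rewrite /= /has_unknown; have [uN|uN] := boolP (None \in u).
    by have := fM u; have := fM v; rewrite !ler_norml /= =>
      /andP[? ?] /andP[? ?]; apply/andP; split; lra.
  by rewrite (refines_determined uv uN) subrr normr0 mulr0.
rewrite !iterS /expect -(refines_size uv).
rewrite -mean_sub; apply: norm_mean_le => l; exact/IH/refines_step.
Qed.

Lemma iter_expect_unknown_antitone t u v : refines u v ->
  iter t expect has_unknown v <= iter t expect has_unknown u.
Proof.
elim: t u v => [|t IH] u v uv.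
  rewrite /= /has_unknown; have [//|uN] := boolP (None \in u);
    first by case: (None \in v).
  by rewrite -(refines_determined uv uN) (negbTE uN).
rewrite !iterS /expect -(refines_size uv); apply: le_mean => l _.
exact/IH/refines_step.
Qed.

End envelope.

(** * Pattern probabilities started from the unknown state *)

Section patterns.
Variables (R : realType) (p q : R).

Local Notation r := (1 - p - q).

(* Expectation of f on a window of n sites at time t, starting from all "?". *)
Definition unknown_start t n (f : seq (option bool) -> R) : R :=
  iter t (expect p q) f (nseq (n + t) None).

Definition pattern t (w : seq (option bool)) : R :=
  unknown_start t (size w) (fun v => (v == w)%:R).

Fixpoint word_sum n (F : seq (option bool) -> R) : R :=
  if n is n'.+1 then
    word_sum n' (fun w => F (Some false :: w))
    + word_sum n' (fun w => F (Some true :: w))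
    + word_sum n' (fun w => F (None :: w))
  else F [::].

Lemma eq_word_sum n F G : (forall l, size l = n -> F l = G l) ->
  word_sum n F = word_sum n G.
Proof.
elim: n F G => [|n IH] F G FG /=; first exact: FG.
by congr (_ + _ + _); apply: IH => l ln; apply: FG; rewrite /= ln.
Qed.

Lemma word_sum0 n : word_sum n (fun=> 0) = 0.
Proof. by elim: n => //= n ->; rewrite !addr0. Qed.

Lemma word_sum_delta f v : word_sum (size v) (fun w => f w * (v == w)%:R) = f v.
Proof.
elim: v f => [|a v IH] f /=; first by rewrite mulr1.
have E b : word_sum (size v) (fun w => f (b :: w) * (a :: v == b :: w)%:R) =
    (a == b)%:R * f (b :: v).
  rewrite -(IH (fun w => f (b :: w))); have [ab|ab] := boolP (a == b).
    by rewrite mul1r; apply: eq_word_sum => w _; rewrite eqseq_cons ab.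
  rewrite mul0r -[RHS](word_sum0 (size v)).
  by apply: eq_word_sum => w _; rewrite eqseq_cons (negbTE ab) mulr0.
by rewrite !E; case: a {E} => [[]|] /=; ring.
Qed.

Lemma iter_expect_word_sum t n (f : seq (option bool) -> seq (option bool) -> R)
  v :
  iter t (expect p q) (fun u => word_sum n (fun w => f w u)) v =
  word_sum n (fun w => iter t (expect p q) (f w) v).
Proof.
elim: n f => [//|n IH] f /=; rewrite -!IH.
have D g h : iter t (expect p q) (fun u => g u + h u) v =
    iter t (expect p q) g v + iter t (expect p q) h v.
  rewrite -[X in _ = X + _]mul1r -[X in _ = _ + X]mul1r -iter_expect_linear.
  by congr (iter _ _ _ _); apply/funext => u; rewrite !mul1r.
by rewrite !D.
Qed.

Lemma unknown_start_word_sum t n f :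
  unknown_start t n f = word_sum n (fun w => f w * pattern t w).
Proof.
rewrite /unknown_start
  (@eq_iter_expect _ p q t n _ (fun v => word_sum n (fun w =>
    f w * (v == w)%:R))).
- rewrite iter_expect_word_sum; apply: eq_word_sum => w <-.
  rewrite -[RHS]addr0 -[X in _ = _ + X](mul0r (iter t (expect p q) (fun=> 0)
    (nseq (size w + t) None))).
  rewrite -iter_expect_linear.
  by congr (iter _ _ _ _); apply/funext => u; rewrite mul0r addr0.
- by move=> w <-; rewrite word_sum_delta.
- by rewrite size_nseq.
Qed.

Definition rate (a b c : option bool) : R :=
  p * (update Trap a b == c)%:R + q * (update Target a b == c)%:R
  + r * (update Open a b == c)%:R.

Fixpoint word_rate (v w : seq (option bool)) : R :=
  match v, w with
  | a :: ((b :: _) as v'), c :: w' => rate a b c * word_rate v' w'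
  | _, _ => 1
  end.

Lemma expect_delta v w : size v = (size w).+1 ->
  expect p q (fun u => (u == w)%:R) v = word_rate v w.
Proof.
elim: w v => [|c w IH] [|a [|b v]] // [vw].
rewrite -[RHS]/(rate a b c * word_rate (b :: v) w) -(IH (b :: v));
  last by rewrite /= vw.
rewrite /expect [(size [:: a, b & v]).-1]/= meanS [(size (b :: v)).-1]/=.
have E d : mean p q (size v) (fun l => (step (d :: l) [:: a, b & v] == c ::
  w)%:R) =
   (update d a b == c)%:R * mean p q (size v) (fun l =>
     (step l (b :: v) == w)%:R).
  set k := update d a b == c; rewrite -[RHS]addr0 -[X in _ = _ + X](mul0r (mean
    p q (size v) (fun=> 0))).
  rewrite -mean_linear; apply: eq_mean => l _.
  rewrite mulr0 addr0 -[step _ _]/(update d a b :: step l (b :: v)) eqseq_cons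
    -/k.
  by case: k; rewrite ?mul1r ?mul0r.
by rewrite !E /rate; ring.
Qed.

Lemma pattern_succ t w : pattern t.+1 w =
  word_sum (size w).+1 (fun v => word_rate v w * pattern t v).
Proof.
(* [iterSr] isolates the innermost [expect], which is the last step in time; the coupling lemmas use
   [iterS], the first step. *)
rewrite [LHS]/pattern /unknown_start iterSr addnS -addSn.
rewrite -/(unknown_start t (size w).+1 _) unknown_start_word_sum.
by apply: eq_word_sum => v vw; rewrite expect_delta.
Qed.

Lemma pattern_cons t w : pattern t w =
  pattern t (Some false :: w) + pattern t (Some true :: w) + pattern t (None ::
    w).
Proof.
rewrite [LHS]/pattern /unknown_start.
rewrite -[nseq _ None]/(behead (nseq ((size w).+1 + t) None))
  -iter_expect_behead.
rewrite -/(unknown_start t (size w).+1 _) unknown_start_word_sum /=.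
have E a : word_sum (size w) (fun u => (u == w)%:R * pattern t (a :: u)) =
  pattern t (a :: w).
  by rewrite -(word_sum_delta (fun u => pattern t (a :: u)));
    apply: eq_word_sum => u _;
    rewrite mulrC eq_sym.
by rewrite !E.
Qed.

Lemma pattern_rev t w : pattern t (rev w) = pattern t w.
Proof.
rewrite [RHS]/pattern /unknown_start -rev_nseq -iter_expect_rev.
rewrite /pattern /unknown_start size_rev; congr (iter _ _ _ _).
by apply/funext => u; congr (_%:R); rewrite -(inj_eq (can_inj (@revK _))) revK.
Qed.

Lemma pattern_rcons t w : pattern t w =
  pattern t (rcons w (Some false)) + pattern t (rcons w (Some true))
  + pattern t (rcons w None).
Proof.
by rewrite -pattern_rev pattern_cons -!rev_rcons !pattern_rev.
Qed.

Lemma pattern_ge0 t w : 0 <= p -> 0 <= q -> p + q <= 1 -> 0 <= pattern t w.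
Proof.
move=> p0 q0 pq; rewrite -[X in X <= _](iter_expect_cst p q t 0 (nseq (size w +
  t) None)).
by apply: le_iter_expect.
Qed.

Lemma pattern_le1 t w : 0 <= p -> 0 <= q -> p + q <= 1 -> pattern t w <= 1.
Proof.
move=> p0 q0 pq; rewrite -[leRHS](iter_expect_cst p q t 1 (nseq (size w + t)
  None)).
by apply: le_iter_expect => // u; case: eqP.
Qed.

End patterns.

Section recurrences.
Variables (R : realType) (p q : R) (t : nat).
Local Notation r := (1 - p - q).
Local Notation O := (Some false).
Local Notation I := (Some true).
Local Notation N := None.
Local Notation pr := (pattern p q).

(** An open site becomes ? exactly from ??, ?0 or 0?. By reflection their total mass is that of ??
    plus 2A, and ?? has mass x - A - B. *)
Lemma pattern_unknown_succ :
  pr t.+1 [:: N] = r * (pr t [:: N] + pr t [:: N; O] - pr t [:: N; I]).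
Proof.
rewrite pattern_succ /= /rate /=.
rewrite -(pattern_rev p q t [:: O; N]) /rev /= [pr t [:: N]]pattern_rcons /=.
ring.
Qed.

(** The 0 comes from a trap, whatever its inputs, or from an open site reading a 1. In the latter
    case the input shared with the ? is not 1, so the three inputs are ??1, 0?1 or ?01; the first
    two add up to ?1 minus 1?1. *)
Lemma pattern_unknown0_succ :
  pr t.+1 [:: N; O] = p * pr t.+1 [:: N] +
    r ^+ 2 * (pr t [:: N; I] - pr t [:: I; N; I] + pr t [:: N; O; I]).
Proof.
rewrite !pattern_succ /= /rate /=.
rewrite (pattern_rcons p q t [:: O; N]) (pattern_rcons p q t [:: N; O])
  (pattern_rcons p q t [:: N; N]) (pattern_cons p q t [:: N; I]) /=.
ring.
Qed.

(** The 1 comes from a target, or from an open site reading 00; then the ? shares a 0 with it and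
    must read ?0. *)
Lemma pattern_unknown1_succ :
  pr t.+1 [:: N; I] = q * pr t.+1 [:: N] + r ^+ 2 * pr t [:: N; O; O].
Proof.
rewrite !pattern_succ /= /rate /=.
rewrite (pattern_rcons p q t [:: O; N]) (pattern_rcons p q t [:: N; O])
  (pattern_rcons p q t [:: N; N])  /=.
ring.
Qed.

(** The final 1 is a target, which leaves q times the recurrence of ?0, or an open site reading 00.
    In the second case the middle 0 is a trap: if open, it would need a 1 in the input shared with
    the ?, which would decide the ?. *)
Lemma pattern_unknown01_succ :
  pr t.+1 [:: N; O; I] = p * q * pr t.+1 [:: N]
    + p * r ^+ 2 * (pr t [:: N; O; O] - pr t [:: I; N; O; O] + pr t [:: N; O; O;
      O])
    + q * r ^+ 2 * (pr t [:: N; I] - pr t [:: I; N; I] + pr t [:: N; O; I]).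
Proof.
have yE : pr t [:: N; N; O; O] =
    pr t [:: N; O; O] - pr t [:: O; N; O; O] - pr t [:: I; N; O; O].
  by rewrite (pattern_cons p q t [:: N; O; O]); ring.
rewrite !pattern_succ /= /rate /=.
rewrite (pattern_rcons p q t [:: O; N]) (pattern_rcons p q t [:: N; O])
  (pattern_rcons p q t [:: N; N]) (pattern_cons p q t [:: N; I]) /=.
rewrite (pattern_rcons p q t [:: O; N; O]) (pattern_rcons p q t [:: O; N; I])
  (pattern_rcons p q t [:: O; N; N]) (pattern_rcons p q t [:: N; O; O])
  (pattern_rcons p q t [:: N; O; I]) (pattern_rcons p q t [:: N; O; N])
  (pattern_rcons p q t [:: N; N; O]) (pattern_rcons p q t [:: N; N; I])
  (pattern_rcons p q t [:: N; N; N]) (pattern_rcons p q t [:: I; N; I]) /=.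
rewrite yE (pattern_rcons p q t [:: N; O; O]) /=.
ring.
Qed.

End recurrences.

(** * Decay of the density of unknown states *)

Section decay.
Variables (R : realType) (p q : R).
Hypotheses (p_ge0 : 0 <= p) (q_ge0 : 0 <= q) (q_lt1 : q < 1).
Hypotheses (pq_le1 : p + q <= 1) (pq_gt0 : 0 < p \/ 0 < q).

Local Notation r := (1 - p - q).
Local Notation pr := (pattern p q).
Local Notation O := (Some false).
Local Notation I := (Some true).
Local Notation N := None.

Let r_ge0 : 0 <= r. Proof. by move: pq_le1; lra. Qed.

Definition unknown_density t : R := pr t [:: N].

(* Adding the recurrences for ?, ?0, ?1 and ?01 with the multipliers D, r * D,
   r ^+ 3 - r * D and r ^+ 3 cancels the contributions of ?0, ?1 and ?01 at
   stationarity; the coefficient kappa of the density of ? is what remains. *)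
Let D := 1 - q * r ^+ 2.
Let kappa := (p + q - p * r + q * r) * D - q * (1 + p) * r ^+ 3.
(** The terms subtracted from [D] are the occurrences of the density of ? at time t + 1 in the
    recurrences, moved to the other side. The value of [D] is chosen for ?01, which returns with
    weight [r ^+ 3 * D + q * r ^+ 5]; this has to be [a4]. *)
Let a1 := D - p * r * D - q * (r ^+ 3 - r * D) - p * q * r ^+ 3.
Let a2 := r * D.
Let a3 := r ^+ 3 - r * D.
Let a4 := r ^+ 3.
Let Phi t := a1 * pr t [:: N] + a2 * pr t [:: N; O] + a3 * pr t [:: N; I]
  + a4 * pr t [:: N; O; I].

Let D_gt0 : 0 < D.
Proof.
have r1 : r <= 1 by move: p_ge0 q_ge0; lra.
have : r ^+ 2 <= 1 by rewrite expr_le1.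
by move=> /(ler_wpM2l q_ge0); rewrite /D; move: q_lt1; lra.
Qed.

(** [kappa] splits into a part with factor p and a part with factor q. Both are nonnegative, and
    whichever of p and q is positive makes its own part positive. *)
Let kappa_gt0 : 0 < kappa.
Proof.
have -> : kappa = p * (p + q) * D + q * ((1 + r) * D - (1 + p) * r ^+ 3).
  by rewrite /kappa /D; ring.
have h2 : 0 < (1 + r) * D - (1 + p) * r ^+ 3.
  have -> : (1 + r) * D - (1 + p) * r ^+ 3 =
     ((1 + r) * (1 - r ^+ 2) + r ^+ 4) + p * r ^+ 2.
    by rewrite /D; ring.
  have r2 : r ^+ 2 <= 1 by rewrite expr_le1 //; move: p_ge0 q_ge0; lra.
  have pr2 : 0 <= p * r ^+ 2 by rewrite mulr_ge0 // exprn_ge0.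
  have [r0|r0] := eqVneq r 0; first by move: pr2; rewrite r0; lra.
  have : 0 < r ^+ 4 by rewrite exprn_gt0 // lt0r r0 r_ge0.
  have : 0 <= (1 + r) * (1 - r ^+ 2) by rewrite mulr_ge0 // ?subr_ge0 //
    addr_ge0.
  by move: pr2; lra.
have h1 : 0 <= p * (p + q) * D by apply: mulr_ge0 (ltW D_gt0);
  rewrite mulr_ge0 // addr_ge0.
case: pq_gt0 => [p0|q0].
  rewrite ltr_pwDl ?mulr_gt0 //; first by move: q_ge0; lra.
  by rewrite mulr_ge0 // ltW.
by rewrite (lt_le_trans (mulr_gt0 q0 h2)) // lerDr.
Qed.

(** The second [p * r ^+ 3] pays for bounding ?000 by ?00. Substituting p = 1 - q - r leaves the
    polynomial 1 - 3r^2 + 2r^3, which has a double root at 1. *)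
Let y_coef_ge0 : 0 <= r * D - r ^+ 3 - p * r ^+ 3 - p * r ^+ 3.
Proof.
have -> : r * D - r ^+ 3 - p * r ^+ 3 - p * r ^+ 3 =
   r * ((1 - r) ^+ 2 * (1 + 2 * r) + q * r ^+ 2).
  by rewrite /D; ring.
apply: mulr_ge0 => //; apply: addr_ge0; apply: mulr_ge0;
  rewrite ?sqr_ge0 ?exprn_ge0 //.
by apply: addr_ge0 => //; apply: mulr_ge0.
Qed.

Let pr_ge0 t w : 0 <= pr t w. Proof. exact: pattern_ge0. Qed.

(** The drop is computed exactly: beyond the density term it consists of the sources ?00, ?000, 1?1
    and 1?00. Only ?000 has a negative coefficient, and ?00 absorbs it. *)
Lemma potential_drop t : kappa * unknown_density t <= Phi t - Phi t.+1.
Proof.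
have -> : Phi t - Phi t.+1 = kappa * unknown_density t
   + r ^+ 2 * ((r * D - r ^+ 3 - p * r ^+ 3) * pr t [:: N; O; O]
               - p * r ^+ 3 * pr t [:: N; O; O; O])
   + (r ^+ 3 * D + q * r ^+ 5) * pr t [:: I; N; I]
   + p * r ^+ 5 * pr t [:: I; N; O; O].
  rewrite /Phi pattern_unknown0_succ pattern_unknown1_succ
    pattern_unknown01_succ.
  by rewrite pattern_unknown_succ /unknown_density /kappa /a1 /a2 /a3 /a4 /D;
    ring.
have yw : pr t [:: N; O; O; O] <= pr t [:: N; O; O].
  rewrite (pattern_rcons p q t [:: N; O; O]) /=.
  by have := pr_ge0 t [:: N; O; O; I]; have := pr_ge0 t [:: N; O; O; N]; lra.
rewrite -addrA -addrA lerDl; apply: addr_ge0; last apply: addr_ge0.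
- apply: mulr_ge0; rewrite ?sqr_ge0 // subr_ge0.
  have pr3_ge0 : 0 <= p * r ^+ 3 by apply: mulr_ge0 => //; rewrite exprn_ge0.
  apply: (le_trans (ler_wpM2l pr3_ge0 yw)).
  by rewrite ler_wpM2r // -subr_ge0.
- apply: mulr_ge0 => //; apply: addr_ge0.
    by apply: mulr_ge0 (ltW D_gt0); rewrite exprn_ge0.
  by apply: mulr_ge0 => //; rewrite exprn_ge0.
- by apply: mulr_ge0 => //; apply: mulr_ge0 => //; rewrite exprn_ge0.
Qed.

Lemma unknown_density_ge0 t : 0 <= unknown_density t.
Proof. exact: pr_ge0. Qed.

Lemma unknown_density_has_unknown t :
  unknown_density t = unknown_start p q t 1 (has_unknown R).
Proof.
apply: (@eq_iter_expect _ _ _ _ 1); last by rewrite size_nseq.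
by case=> [//|a [|//]] _; rewrite /has_unknown inE eqseq_cons andbT eq_sym.
Qed.

(** Forgetting whatever the first step has decided leaves t + 1 unknown sites, the start for t
    further steps. *)
Lemma unknown_density_decr t : unknown_density t.+1 <= unknown_density t.
Proof.
rewrite !unknown_density_has_unknown /unknown_start iterS /expect size_nseq.
rewrite -[leRHS](mean_cst p q (1 + t.+1).-1); apply: le_mean => // l ln.
apply: iter_expect_unknown_antitone => //.
have := refines_nseq (step l (nseq (1 + t.+1) None)).
by rewrite size_step size_nseq ln minnn.
Qed.

Lemma unknown_density_bound : exists2 K : R, 0 <= K &
  forall t, unknown_density t <= K * (t.+1)%:R^-1.
Proof.
have ab (a x : R) : 0 <= x -> x <= 1 -> - `|a| <= a * x <= `|a|.
  move=> x0 x1; rewrite -ler_norml normrM -[leRHS]mulr1 ler_wpM2l //.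
  by rewrite ger0_norm.
have pr_le1 t w : pr t w <= 1 by exact: pattern_le1.
set C := `|a1| + `|a2| + `|a3| + `|a4|.
have PhiC t : - C <= Phi t <= C.
  have /andP[? ?] := ab a1 _ (pr_ge0 t [:: N]) (pr_le1 _ _).
  have /andP[? ?] := ab a2 _ (pr_ge0 t [:: N; O]) (pr_le1 _ _).
  have /andP[? ?] := ab a3 _ (pr_ge0 t [:: N; I]) (pr_le1 _ _).
  have /andP[? ?] := ab a4 _ (pr_ge0 t [:: N; O; I]) (pr_le1 _ _).
  by rewrite /Phi /C; apply/andP; split; lra.
(* The drops telescope, and each density before time t is at least the one at t. *)
have S t : kappa * t%:R * unknown_density t <= Phi 0%N - Phi t.
  elim: t => [|t IH]; first by rewrite mulr0 mul0r subrr.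
  have : kappa * t.+1%:R * unknown_density t.+1 <= kappa * t.+1%:R *
    unknown_density t.
    by rewrite ler_wpM2l ?unknown_density_decr // mulr_ge0 // ltW.
  by have := potential_drop t; rewrite -natr1; lra.
have C0 : 0 <= C by rewrite !addr_ge0.
(* [2 * C] bounds the oscillation of [Phi]; the extra [kappa] pays for passing from t to t + 1, the
   density being at most 1. *)
exists ((2 * C + kappa) / kappa).
  by apply: divr_ge0 (ltW kappa_gt0); apply: addr_ge0 (ltW kappa_gt0);
    rewrite mulr_ge0.
move=> t; rewrite mulrAC ler_pdivlMr // ler_pdivlMr ?ltr0n //.
have := S t; have := PhiC 0%N; have := PhiC t => /andP[? ?] /andP[? ?].
have : kappa * unknown_density t <= kappa * 1 by rewrite ler_wpM2l ?pr_le1 //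
  ltW.
by rewrite -natr1; lra.
Qed.

(** Shifting removes sites on the left only: it brings the site to position 0, reflection moves it
    to the last position, and shifting then removes all other sites. *)
Lemma unknown_start_nth t n i : (i < n)%N ->
  unknown_start p q t n (fun w => (nth None w i == None)%:R) = unknown_density
    t.
Proof.
pose e n i := unknown_start p q t n (fun w => (nth None w i == None)%:R).
have e_shift m j : e m.+1 j.+1 = e m j.
  rewrite /e /unknown_start -[nseq (m + t) None]/(behead (nseq (m.+1 + t)
    None)).
  rewrite -iter_expect_behead; congr (iter _ _ _ _); apply/funext => w.
  by rewrite nth_behead.
have e_rev m : e m.+1 0%N = e m.+1 m.
  rewrite /e /unknown_start -[in RHS]rev_nseq -iter_expect_rev.
  apply: (@eq_iter_expect _ _ _ _ m.+1); last by rewrite size_nseq.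
  by move=> w wm; rewrite nth_rev wm // subSS subnn.
have e0 m : e m.+1 m = e 1%N 0%N by elim: m => // m <-; exact: e_shift.
rewrite -/(e n i) => lt_in.
have -> : e n i = e (n - i)%N 0%N.
  rewrite -{1}(subnK (ltnW lt_in)); elim: i {lt_in} (n - i)%N => [|i IH] m.
    by rewrite addn0.
  by rewrite addnS e_shift IH.
case: (n - i)%N (subn_gt0 i n) => [|m _]; first by rewrite lt_in.
rewrite e_rev e0; apply: (@eq_iter_expect _ _ _ _ 1); last by rewrite size_nseq.
by case=> [//|a [|//]] _; rewrite eqseq_cons andbT.
Qed.

Lemma unknown_start_has_unknown t n :
  unknown_start p q t n (has_unknown R) <= n%:R * unknown_density t.
Proof.
elim: n => [|n IH].
  rewrite mul0r /unknown_start.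
  rewrite (@eq_iter_expect _ _ _ _ 0 _ (fun=> 0)) ?iter_expect_cst ?size_nseq
    //.
  by move=> w /size0nil ->.
rewrite -natr1 mulrDl mul1r addrC.
apply: le_trans (lerD (lexx _) IH); rewrite -(@unknown_start_nth t n.+1 0) //.
rewrite /unknown_start -[nseq (n + t) None]/(behead (nseq (n.+1 + t) None))
  -iter_expect_behead.
rewrite -[X in _ <= X + _]mul1r -[X in _ <= _ + X]mul1r -iter_expect_linear.
rewrite (@eq_iter_expect _ _ _ _ n.+1 _
  (fun w => Num.min (has_unknown R w) (1 * (nth None w 0 == None)%:R + 1 *
    has_unknown R (behead w)))).
- by apply: le_iter_expect => // w; rewrite ge_min lexx orbT.
- case=> [//|a w] _; apply/esym/min_idPl; rewrite /has_unknown inE !mul1r /=.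
  by rewrite eq_sym; case: (a == None) => /=; rewrite ?lerDl ?add0r.
- by rewrite size_nseq.
Qed.

(** Every word of length n + t refines the unknown one, so v matters at time t only when the window
    started from all ? still contains a ?. *)
Lemma loss_of_memory t n f (M : R) v : (forall w, `|f w| <= M) ->
  size v = (n + t)%N ->
  `|iter t (expect p q) f v - unknown_start p q t n f| <=
  2 * M * (n%:R * unknown_density t).
Proof.
move=> fM vn; have M0 : 0 <= M by apply: le_trans (fM [::]).
apply: (@le_trans _ _ (2 * M * unknown_start p q t n (has_unknown R))).
  by apply: iter_expect_refines => //; rewrite -vn refines_nseq.
by rewrite ler_wpM2l ?unknown_start_has_unknown // mulr_ge0.
Qed.

End decay.

(** * Extension of consistent cylinder probabilities *)

Section random_bits.
Variables (R : realType) (m : seq bool -> R).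
Hypotheses (m_ge0 : forall w, 0 <= m w) (m_nil : m [::] = 1)
  (m_cons : forall w, m w = m (false :: w) + m (true :: w)).

(* Words list the most recent bit first. The reals of [0, 1) with digits w form
   the interval [left_end w, left_end w + m w), which is cut in proportion to
   the masses of the two extensions of w. *)
Fixpoint left_end (w : seq bool) : R :=
  if w is b :: w' then left_end w' + (if b then m (false :: w') else 0) else 0.

Fixpoint digits n (u : R) : seq bool :=
  if n is n'.+1 then
    let w := digits n' u in (left_end w + m (false :: w) <= u) :: w
  else [::].

Lemma digitsP n u w : 0 <= u < 1 -> size w = n ->
  (digits n u == w) = (left_end w <= u < left_end w + m w).
Proof.
move=> u01; elim: n w => [|n IH] [|b w] //= => [_|[wn]].
  by rewrite m_nil add0r u01.
have mf := m_ge0 (false :: w); have mt := m_ge0 (true :: w).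
have mw := m_cons w.
have step_eq : digits n u == w -> (left_end (digits n u) + m (false :: digits n
  u) <= u)
    = (left_end w + m (false :: w) <= u) by move=> /eqP ->.
rewrite eqseq_cons; apply/idP/idP.
  move=> /andP[/eqP bE dw]; move: bE; rewrite step_eq // => bE.
  move: dw; rewrite (IH w wn) => /andP[h1 h2].
  by move: bE; case: b => [|/negbT]; rewrite -?ltNge => h3; apply/andP; split;
    lra.
move=> /andP[h1 h2].
have dw : digits n u == w.
  by rewrite (IH w wn); case: b h1 h2 => h1 h2; apply/andP; split; lra.
rewrite step_eq // dw andbT; apply/eqP.
case: b h1 h2 => h1 h2; first exact: h1.
by apply/negbTE; rewrite -ltNge; lra.
Qed.

Lemma measurable_digits n w : measurable [set u : measurableTypeR R | digits n u
  = w].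
Proof.
elim: n w => [|n IH] w.
  have [->|wN] := eqVneq w [::].
    by rewrite [X in measurable X](_ : _ = setT) //; apply/seteqP; split.
  rewrite [X in measurable X](_ : _ = set0) //; apply/seteqP;
    split => // u /= wE.
  by rewrite wE eqxx in wN.
case: w => [|b w].
  by rewrite [X in measurable X](_ : _ = set0) //; apply/seteqP; split.
rewrite [X in measurable X](_ : _ = [set u : measurableTypeR R | digits n u = w]
  `&`
   [set u : measurableTypeR R | (left_end w + m (false :: w) <= u) = b]);
     last first.
  by apply/seteqP; split => u /=; [move=> [<- <-]|move=> [-> ->]].
apply: measurableI => //.
have mI : measurable [set u : measurableTypeR R | left_end w + m (false :: w) <=
  u].
  rewrite [X in measurable X](_ : _ = `[left_end w + m (false :: w),
    +oo[%classic).
    exact: measurable_itv.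
  by apply/seteqP; split => u /=; rewrite in_itv /= andbT.
case: b => //.
rewrite [X in measurable X](_ : _ = ~` [set u : measurableTypeR R | left_end w +
  m (false :: w) <= u]).
  exact: measurableC.
by apply/seteqP; split => u /=; [move=> ->|move=> /negP/negbTE].
Qed.

Definition digit i (u : R) : bool := head false (digits i.+1 u).

Lemma digits_digit n u : digits n u = rev (mkseq (fun i => digit i u) n).
Proof.
by elim: n => [//|n IH]; rewrite mkseqS rev_rcons -IH.
Qed.

Lemma measurable_digit i b : measurable [set u : measurableTypeR R | digit i u =
  b].
Proof.
have mt : measurable [set u : measurableTypeR R | digit i u = true].
  rewrite [X in measurable X](_ : _ = \bigcup_(w : seq bool)
     (if head false w then [set u : measurableTypeR R | digits i.+1 u = w] else
       set0)).
    apply: (countable_bigcupT_measurable (countableP _)) => w.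
    by case: ifP => // _; exact: measurable_digits.
  apply/seteqP; split=> [u du|u [w _]].
    by exists (digits i.+1 u); rewrite // -[head _ _]/(digit i u) du.
  by case: ifP => // hw dw; rewrite /mkset /digit (dw : digits i.+1 u = w).
case: b => //.
rewrite [X in measurable X](_ : _ = ~` [set u : measurableTypeR R | digit i u =
  true]).
  exact: measurableC.
by apply/seteqP; split => u /=; [move=> ->|move=> /negP/negbTE].
Qed.

End random_bits.

Section unit_interval.
Variable R : realType.

Definition unit_prob : set (measurableTypeR R) -> \bar R :=
  mrestr (@lebesgue_measure R) (measurable_itv `[(0 : R), 1[).

HB.instance Definition _ := Measure.on unit_prob.

Let unit_prob_setT : unit_prob setT = 1%E.
Proof. by rewrite /unit_prob /mrestr setTI lebesgue_measure_itv /= lte_fin ltr01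
  sube0. Qed.

HB.instance Definition _ := @Measure_isProbability.Build _ _ R unit_prob
  unit_prob_setT.

End unit_interval.

Lemma measurable_coordinate n b : measurable [set eta : config | eta n = b].
Proof. by apply: sub_sigma_algebra; exists n, b. Qed.

Definition cylinder (s : seq int) (c : int -> bool) : set config :=
  [set eta | forall n, n \in s -> eta n = c n].

Lemma measurable_cylinder s c : measurable (cylinder s c).
Proof.
elim: s => [|k s IH].
  by rewrite [X in measurable X](_ : _ = setT) //; apply/seteqP; split.
rewrite [X in measurable X](_ : _ =
    [set eta : config | eta k = c k] `&` cylinder s c).
  by apply: measurableI => //; exact: measurable_coordinate.
apply/seteqP; split => eta /=.
  by move=> ec; split=> [|n ns]; apply: ec; rewrite inE ?eqxx // ns orbT.
by move=> [ek ec] n; rewrite inE => /predU1P[->|/ec].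
Qed.

Definition set_at (c : int -> bool) k b : int -> bool :=
  fun n => if n == k then b else c n.

Lemma cylinder_split (R : realType) (nu : probability config R) k s c :
  k \notin s ->
  nu (cylinder s c) = (nu (cylinder (k :: s) (set_at c k false)) +
                       nu (cylinder (k :: s) (set_at c k true)))%E.
Proof.
move=> ks; rewrite -measureU //; try exact: measurable_cylinder.
  congr (nu _); apply/seteqP; split => eta /=.
    move=> ec; case ek: (eta k); [right|left] => n; rewrite inE /set_at;
      case: eqP => [-> //|_ /= ns]; exact: ec.
  move=> [] ec n ns; have := ec n; rewrite inE ns orbT /set_at.
    by case: eqP ns => [->|_ _ ->] //; rewrite (negbTE ks).
  by case: eqP ns => [->|_ _ ->] //; rewrite (negbTE ks).
apply/seteqP; split => // eta /= [e0 e1].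
by have := e0 k (mem_head _ _); rewrite (e1 k (mem_head _ _)) /set_at eqxx.
Qed.

Section extension.
Variables (R : realType) (M : seq int -> (int -> bool) -> R).
Hypotheses (M_ge0 : forall s c, 0 <= M s c) (M_nil : forall c, M [::] c = 1).
Hypothesis M_congr : forall s c c', (forall n, n \in s -> c n = c' n) -> M s c =
  M s c'.
Hypothesis M_perm : forall s s' c, perm_eq s s' -> M s c = M s' c.

Hypothesis M_cons : forall k s c, uniq (k :: s) ->
  M s c = M (k :: s) (set_at c k false) + M (k :: s) (set_at c k true).

(** Enumerates the integers as 0, -1, 1, -2, and so on. *)
Let site_at n : int := if odd n then Negz n./2 else Posz n./2.
Let index_of (k : int) : nat :=
  match k with Posz n => n.*2 | Negz n => n.*2.+1 end.

Let index_ofK : cancel index_of site_at.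
Proof.
case=> n; rewrite /site_at /= odd_double ?doubleK //=.
by rewrite uphalf_double.
Qed.

Let site_atK : cancel site_at index_of.
Proof.
by move=> n; rewrite /site_at; case: ifP => n_odd /=;
  rewrite -[RHS]odd_double_half n_odd.
Qed.

(** Reversed, so that a new site comes in front, like the most recent bit of a word of digits. *)
Let first_sites n : seq int := rev (mkseq site_at n).

Let first_sitesS n : first_sites n.+1 = site_at n :: first_sites n.
Proof. by rewrite /first_sites mkseqS rev_rcons. Qed.

Let mem_first_sites n k : (k \in first_sites n) = (index_of k < n)%N.
Proof.
rewrite mem_rev; apply/mapP/idP => [[i]|kn].
  by rewrite mem_iota /= => ? ->; rewrite site_atK.
by exists (index_of k); rewrite ?index_ofK // mem_iota.
Qed.

Let first_sites_uniq n : uniq (first_sites n).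
Proof. by rewrite rev_uniq mkseq_uniq //; exact: can_inj site_atK. Qed.

Let assignment (w : seq bool) : int -> bool := fun k =>
  nth false (rev w) (index_of k).

Let m w := M (first_sites (size w)) (assignment w).

Let m_cons w : m w = m (false :: w) + m (true :: w).
Proof.
rewrite /m (@M_cons (site_at (size w))); last by rewrite -first_sitesS.
rewrite -first_sitesS; congr (_ + _); apply: M_congr => k;
  rewrite mem_first_sites /set_at /assignment ltnS rev_cons nth_rcons size_rev;
  rewrite -(inj_eq (can_inj index_ofK)) site_atK leq_eqVlt;
  by case: eqP => [->|_ /= ->]; rewrite ?ltnn.
Qed.

Let m_ge0 w : 0 <= m w. Proof. exact: M_ge0. Qed.

Let m_nil : m [::] = 1. Proof. exact: M_nil. Qed.

Let Phi (u : measurableTypeR R) : config := fun k => digit m (index_of k) u.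

Let measurable_Phi : measurable_fun setT Phi.
Proof.
apply: (@measurability _ _ _ _ _ _ coordinate_events) => // _ [_ [k [b ->]] <-].
by rewrite setTI; exact: measurable_digit.
Qed.

(** Prescribing the first n sites prescribes the first n digits, so the event is a single
    subinterval of [0, 1), of length [m w]. *)
Let cylinder_first_sites n c :
  unit_prob [set u | forall k, k \in first_sites n -> Phi u k = c k] =
  (M (first_sites n) c)%:E.
Proof.
pose w := rev (mkseq (c \o site_at) n).
have wn : size w = n by rewrite size_rev size_mkseq.
have -> : M (first_sites n) c = m w.
  rewrite /m wn; apply: M_congr => k; rewrite mem_first_sites => kn.
  by rewrite /assignment /w revK nth_mkseq //= index_ofK.
have h0 : 0 <= left_end m w.
  by elim: (w) => //= b v IH; apply: addr_ge0 => //; case: b => //;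
    exact: M_ge0.
have h1 : left_end m w + m w <= 1.
  elim: (w) => [|b v IH] /=; first by rewrite m_nil add0r.
  by move: IH (M_ge0 (first_sites (size v).+1) (assignment (false :: v)))
     (M_ge0 (first_sites (size v).+1) (assignment (true :: v)));
   rewrite (m_cons v) -[M _ _]/(m (false :: v)) -[M _ _]/(m (true :: v));
     case: b; lra.
rewrite /unit_prob /mrestr [X in lebesgue_measure X](_ : _ =
   `[left_end m w, left_end m w + m w[%classic).
  rewrite lebesgue_measure_itv /= lte_fin; case: ltP => [_|].
    by rewrite -EFinB [_ + m w]addrC addrK.
  by rewrite -[X in _ <= X]addr0 lerD2l => m0; apply/esym; congr (_%:E);
    apply/eqP; rewrite eq_le m0 M_ge0.
have digits_w u : (forall k, k \in first_sites n -> Phi u k = c k) <-> digits m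
  n u == w.
  rewrite digits_digit (inj_eq (can_inj revK)); split=> [uc|/eqP uw k].
    apply/eqP/eq_in_map => i; rewrite mem_iota /= => ni.
    by rewrite -uc ?mem_first_sites /Phi site_atK.
  rewrite mem_first_sites => kn; have := congr1 (nth false ^~ (index_of k)) uw.
  by rewrite !nth_mkseq //= index_ofK.
apply/seteqP; split => u /=; rewrite !in_itv /=.
  by move=> [/digits_w dw u01]; rewrite -(digitsP m_ge0 m_nil m_cons _ wn).
move=> uw; have u01 : 0 <= u < 1 by move: uw h0 h1 => /andP[? ?] ? ?;
  apply/andP; split; lra.
by split=> //; apply/digits_w; rewrite (digitsP m_ge0 m_nil m_cons).
Qed.

(** The image of Lebesgue measure under [Phi] is right on blocks of first sites. Other lists follow
    by induction on the number d of sites missing from such a block: splitting over the state of a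
    missing site lowers d. *)
Lemma config_extension : exists nu : probability config R,
  forall s c, uniq s -> nu (cylinder s c) = (M s c)%:E.
Proof.
pose X : {mfun measurableTypeR R >-> config} :=
  HB.pack Phi (isMeasurableFun.Build _ _ _ _ Phi measurable_Phi).
pose nu : probability config R := distribution (@unit_prob R) X.
exists nu => s c us.
have [N sN] : exists N, forall k, k \in s -> (index_of k < N)%N.
  exists (\max_(k <- s) index_of k).+1 => k ks.
  by rewrite ltnS; exact: leq_bigmax_seq.
have [d] : exists d, (size s + d)%N = N.
  exists (N - size s)%N; rewrite subnKC //.
  have : {subset s <= first_sites N} by move=> k /sN; rewrite mem_first_sites.
  by move=> /(uniq_leq_size us); rewrite size_rev size_mkseq.
elim: d s c us sN => [|d IH] s c us sN.
  rewrite addn0 => sE.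
  have sP : perm_eq s (first_sites N).
    have sub : {subset s <= first_sites N} by move=> k /sN;
      rewrite mem_first_sites.
    apply: uniq_perm => //; have [] // := uniq_min_size us sub.
    by rewrite size_rev size_mkseq sE.
  rewrite (M_perm _ sP) -cylinder_first_sites; congr (unit_prob _).
  by apply/seteqP; split => u /= uc k ks; apply: uc;
    rewrite ?(perm_mem sP) // -(perm_mem sP).
move=> sE.
have [k kN ks] : exists2 k, k \in first_sites N & k \notin s.
  apply/hasP; rewrite has_predC; apply/negP => /allP sub.
  have := uniq_leq_size (first_sites_uniq N) sub.
  by rewrite size_rev size_mkseq -sE addnS ltnNge leq_addr.
have uks : uniq (k :: s) by rewrite /= ks.
rewrite (M_cons c uks) EFinD (cylinder_split nu c ks).
have sdN b : nu (cylinder (k :: s) (set_at c k b)) =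
    (M (k :: s) (set_at c k b))%:E.
  apply: IH => //; last by rewrite /= addSnnS.
  by move=> j; rewrite inE => /predU1P[->|/sN //]; rewrite -mem_first_sites.
by rewrite !sdN.
Qed.

End extension.

(** * Windows of configurations and the automaton *)

Section windows.
Implicit Types (eta : config) (a : int).

Definition sites a n : seq int := mkseq (fun i => a + i%:Z) n.

Definition window a n eta : seq (option bool) := [seq Some (eta k) | k <- sites
  a n].

Lemma sitesS a n : sites a n.+1 = a :: sites (a + 1) n.
Proof.
rewrite /sites /mkseq /= addr0 -[1%N]addn0 iotaDl -map_comp; congr cons.
by apply: eq_map => i /=; rewrite -addrA.
Qed.

Lemma mem_sites a n k : (k \in sites a n) = (a <= k < a + n%:Z).
Proof.
elim: n a => [|n IH] a; first by rewrite in_nil; lia.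
by rewrite sitesS inE IH; lia.
Qed.

Lemma sites_uniq a n : uniq (sites a n).
Proof. by rewrite mkseq_uniq // => i j; lia. Qed.

Lemma windowS a n eta : window a n.+1 eta = Some (eta a) :: window (a + 1) n
  eta.
Proof. by rewrite /window sitesS. Qed.

Lemma size_window a n eta : size (window a n eta) = n.
Proof. by rewrite size_map size_mkseq. Qed.

Lemma window_eqP a w eta : window a (size w) eta = map Some w <->
  forall k, k \in sites a (size w) -> eta k = nth false w `|k - a|%N.
Proof.
elim: w a => [|b w IH] a; first by split.
rewrite [size _]/= windowS sitesS [map _ _]/=; split.
  case=> ea /IH ew k; rewrite inE => /predU1P[->|kw]; first by rewrite subrr.
  rewrite (ew k kw); move: kw; rewrite mem_sites => kw.
  by have -> : `|k - a|%N = `|(k - (a + 1))%R|%N.+1 by lia.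
move=> ew; congr cons; first by rewrite ew ?mem_head // subrr.
apply/IH => k kw; rewrite ew ?inE ?kw ?orbT //; move: kw;
  rewrite mem_sites => kw.
by have -> : `|k - a|%N = `|(k - (a + 1))%R|%N.+1 by lia.
Qed.

Lemma known_word (w : seq (option bool)) : None \notin w ->
  w = map Some (map (odflt false) w).
Proof.
by elim: w => [//|[b|] w IH]; rewrite inE //= => wN; rewrite -IH.
Qed.

Lemma window_known a n eta : None \notin window a n eta.
Proof. by apply/mapP => -[]. Qed.

Lemma measurable_window_eq a n w : measurable [set eta | window a n eta = w].
Proof.
have [wn|wn] := eqVneq (size w) n; last first.
  rewrite [X in measurable X](_ : _ = set0) //; apply/seteqP;
    split => // eta /= ew.
  by rewrite -ew size_window eqxx in wn.
have [wN|wN] := boolP (None \in w).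
  rewrite [X in measurable X](_ : _ = set0) //; apply/seteqP;
    split => // eta /= ew.
  by have := window_known a n eta; rewrite ew wN.
rewrite (known_word wN) -wn; set w' := map (odflt false) w.
have -> : size w = size w' by rewrite /w' size_map.
rewrite [X in measurable X](_ : _ =
  cylinder (sites a (size w')) (fun k => nth false w' `|k - a|%N)).
  exact: measurable_cylinder.
by apply/seteqP; split => eta /=; move/window_eqP.
Qed.

End windows.

(** * Integrals of window functions and one step of the automaton *)

Section window_integrals.
Variable R : realType.
Implicit Types (nu mu : probability config R) (f : seq (option bool) -> R).

(** Measurability, integrability and integrals of window functions are all reduced to this finite
    combination of indicators. *)
Lemma window_delta f a n eta : f (window a n eta) =
  word_sum n (fun w => f w * \1_[set eta | window a n eta = w] eta).
Proof.
rewrite -(word_sum_delta f) size_window; apply: eq_word_sum => w _.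
by rewrite indicE; congr (_ * _%:R); congr nat_of_bool; apply/eqP/idP;
  rewrite inE.
Qed.

Lemma measurable_word_sum n (F : seq (option bool) -> config -> R) :
  (forall w, measurable_fun setT (F w)) ->
  measurable_fun setT (fun eta => word_sum n (F^~ eta)).
Proof.
elim: n F => [//|n IH] F mF; first exact: mF.
by apply: measurable_funD; [apply: measurable_funD|]; apply: IH.
Qed.

Lemma measurable_window f a n : measurable_fun setT (fun eta =>
  f (window a n eta)).
Proof.
under eq_fun do rewrite window_delta.
apply: measurable_word_sum => w; apply: measurable_funM => //.
by apply: measurable_indic; exact: measurable_window_eq.
Qed.

Lemma norm_le_word_sum f n w : size w = n -> `|f w| <= word_sum n (fun v =>
  `|f v|).
Proof.
have ge0 m (g : seq (option bool) -> R) : 0 <= word_sum m (fun v => `|g v|).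
  by elim: m g => [|m IH] g //=; rewrite !addr_ge0.
elim: n f w => [|n IH] f [|b w] //= [wn].
have := IH (f \o cons b) w wn.
have := ge0 n (f \o cons (Some false)); have := ge0 n (f \o cons (Some true)).
by have := ge0 n (f \o cons None); case: b => [[]|] /=; lra.
Qed.

Lemma integrable_bounded nu (g : config -> R) (B : R) :
  measurable_fun setT g -> (forall eta, `|g eta| <= B) ->
  nu.-integrable setT (EFin \o g).
Proof.
move=> mg gB; apply: measurable_bounded_integrable => //.
  by apply: (le_lt_trans (probability_le1 nu measurableT)); rewrite ltry.
exists B; split; first exact: num_real.
by move=> x Bx eta _ /=; exact: le_trans (gB eta) (ltW Bx).
Qed.

Lemma integrable_window nu f a n :
  nu.-integrable setT (EFin \o (fun eta => f (window a n eta))).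
Proof.
apply: (@integrable_bounded _ _ (word_sum n (fun v => `|f v|))).
  exact: measurable_window.
by move=> eta; apply: norm_le_word_sum; rewrite size_window.
Qed.

Lemma integrable_word_sum nu n (F : seq (option bool) -> config -> R) :
  (forall w, nu.-integrable setT (EFin \o F w)) ->
  nu.-integrable setT (EFin \o (fun eta => word_sum n (F^~ eta))).
Proof.
elim: n F => [|n IH] F iF; first exact: iF.
have iFb b := IH (fun w => F (b :: w)) (fun w => iF (b :: w)).
have := integrableD measurableT (integrableD measurableT (iFb (Some false)) (iFb
  (Some true))) (iFb None).
by [].
Qed.

Lemma Rintegral_word_sum nu n (F : seq (option bool) -> config -> R) :
  (forall w, nu.-integrable setT (EFin \o F w)) ->
  \int[nu]_eta word_sum n (F^~ eta) = word_sum n (fun w =>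
    \int[nu]_eta F w eta).
Proof.
elim: n F => [//|n IH] F iF.
have iFb b := @integrable_word_sum nu n (fun w => F (b :: w)) (fun w =>
  iF (b :: w)).
have iF2 := integrableD measurableT (iFb (Some false)) (iFb (Some true)).
rewrite /= RintegralD // RintegralD //.
by congr (_ + _ + _); apply: IH.
Qed.

Lemma Rintegral_window nu f a n : \int[nu]_eta f (window a n eta) =
  word_sum n (fun w => f w * fine (nu [set eta | window a n eta = w])).
Proof.
under eq_Rintegral do rewrite window_delta.
have mw w := measurable_window_eq a n w.
have iw w : nu.-integrable setT (EFin \o \1_[set eta | window a n eta = w]).
  by apply: integrable_indic.
rewrite Rintegral_word_sum; last first.
  by move=> w; exact: integrableZl (iw w).
apply: eq_word_sum => w _; rewrite RintegralZl //; congr (_ * _).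
by rewrite /Rintegral integral_indic // setIT.
Qed.

Variables p q : R.

(** Averaging over the label recovers A_{p,q}: on inputs 00 only a trap yields 0, on other known
    inputs only a target yields 1. *)
Lemma pca_rateE a b c : pca_rate p q a b c = rate p q (Some a) (Some b) (Some
  c).
Proof. by case: a b c => [] [] []; rewrite /pca_rate /rate /=; ring. Qed.

Lemma pca_rate_window a w eta :
  \prod_(n <- sites a (size w)) pca_rate p q (eta (n - 1)) (eta n) (nth false w
    `|n - a|%N) =
  word_rate p q (window (a - 1) (size w).+1 eta) (map Some w).
Proof.
elim: w a => [|b w IH] a.
  by rewrite big_nil windowS.
rewrite [size _]/= sitesS big_cons subrr windowS subrK windowS.
rewrite -[word_rate _ _ _ _]/(rate p q (Some (eta (a - 1))) (Some (eta a)) (Some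
  b) *
  word_rate p q (Some (eta a) :: window (a + 1) (size w) eta) (map Some w))
    -windowS.
rewrite pca_rateE; congr (_ * _); have := IH (a + 1); rewrite addrK => <-.
apply: eq_big_seq => k; rewrite mem_sites => kw.
by have -> : `|k - a|%N = `|(k - (a + 1))%R|%N.+1 by lia.
Qed.

Lemma word_rate_known v w : size v = (size w).+1 -> None \notin v -> None \in w
  ->
  word_rate p q v w = 0.
Proof.
elim: w v => [//|c w IH] [|a [|b v]] //= [vw].
rewrite !inE !negb_or => /and3P[aN bN vN]; case: c => [c|] /=.
  by move=> wN; rewrite -/(word_rate p q (b :: v) w) IH ?mulr0 //= ?vw // inE
    negb_or bN.
by rewrite /rate; case: a b aN bN {IH} => [[]|] [[]|] //= _ _;
  rewrite !mulr0 !addr0 mul0r.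
Qed.

Lemma expect_word_sum f v n : size v = n.+1 ->
  expect p q f v = word_sum n (fun w => f w * expect p q (fun u =>
    (u == w)%:R) v).
Proof.
move=> vn; rewrite -[LHS]/(iter 1 (expect p q) f v).
rewrite (@eq_iter_expect _ p q 1 n _ (fun u => word_sum n (fun w =>
  f w * (u == w)%:R))).
- rewrite iter_expect_word_sum; apply: eq_word_sum => w _ /=.
  rewrite -[RHS]addr0 -[X in _ = _ + X](mul0r (expect p q (fun=> 0) v))
    -expect_linear.
  by congr (expect _ _ _ _); apply/funext => u; rewrite mul0r addr0.
- by move=> u <-; rewrite word_sum_delta.
- by rewrite vn addn1.
Qed.

(** [expect] is the dual of A_{p,q} on window functions; the window gains a site on the left because
    n reads n - 1 and n. *)
Lemma pca_law_window mu nu f a n : pca_law p q mu nu ->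
  \int[nu]_eta f (window a n eta) =
  \int[mu]_eta expect p q f (window (a - 1) n.+1 eta).
Proof.
move=> law; rewrite Rintegral_window.
transitivity (word_sum n (fun w => f w *
  \int[mu]_eta expect p q (fun u => (u == w)%:R) (window (a - 1) n.+1 eta))).
  apply: eq_word_sum => w wn; congr (_ * _).
  have sw eta : size (window (a - 1) n.+1 eta) = (size w).+1.
    by rewrite size_window wn.
  under eq_Rintegral do rewrite (expect_delta p q (sw _)).
  (* [pca_law] speaks of known states only; for words containing ? both sides vanish. *)
  have [wN|wN] := boolP (None \in w).
    rewrite [X in nu X](_ : _ = set0) ?measure0; last first.
      apply/seteqP; split => // eta /= ew.
      by have := window_known a n eta; rewrite ew wN.
    under eq_Rintegral do rewrite word_rate_known ?window_known ?sw //.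
    by rewrite Rintegral_cst ?mul0r.
  move: wn; rewrite (known_word wN); set w' := map (odflt false) w => w'n.
  have {}w'n : size w' = n by rewrite -w'n [RHS]size_map.
  rewrite -w'n [X in nu X](_ : _ =
    [set eta | forall k, k \in sites a (size w') -> eta k = nth false w' `|k -
      a|%N]); last first.
    by apply/seteqP; split => eta /=; move/window_eqP.
  rewrite law ?sites_uniq // /Rintegral; congr fine.
  by apply: eq_integral => eta _; rewrite -pca_rate_window.
rewrite (@eq_Rintegral _ _ _ mu setT (fun eta => word_sum n (fun w =>
  f w * expect p q (fun u => (u == w)%:R) (window (a - 1) n.+1 eta)))).
  rewrite Rintegral_word_sum; last first.
    move=> w; exact: integrable_window (fun v => f w * expect p q (fun u =>
      (u == w)%:R) v) _ _.
  apply: eq_word_sum => w _; rewrite RintegralZl //.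
  exact: integrable_window (expect p q (fun u => (u == w)%:R)) _ _.
by move=> eta _; rewrite (@expect_word_sum _ _ n) // size_window.
Qed.

End window_integrals.

Lemma Rintegral_probability_cst d (T : measurableType d) (R : realType)
  (nu : probability T R) (c : R) : \int[nu]_eta c = c.
Proof.
rewrite Rintegral_cst // -[RHS]mulr1; congr (_ * _).
exact: (congr1 fine (probability_setT nu)).
Qed.

Lemma cylinder_window (R : realType) s c : exists (f : seq (option bool) -> R) a
  n, (forall w, `|f w| <= 1) /\
  forall nu : probability config R, fine (nu (cylinder s c)) = \int[nu]_eta f
    (window a n eta).
Proof.
pose N := (\max_(k <- s) `|k|%N).+1.
have sN k : k \in s -> k \in sites (- N%:Z) (N + N)%N.
  move=> ks; rewrite mem_sites.
  have : (`|k| < N)%N by rewrite ltnS; exact: (@leq_bigmax_seq _ s xpredT absz).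
  by lia.
pose f (w : seq (option bool)) : R :=
  (all (fun k => nth None w `|(k + N%:Z)%R|%N == Some (c k)) s)%:R.
exists f, (- N%:Z), (N + N)%N; split.
  by move=> w; rewrite /f; case: all; rewrite ?normr1 ?normr0.
move=> nu; have mc := measurable_cylinder s c.
rewrite -[RHS](_ : \int[nu]_eta \1_(cylinder s c) eta = _).
  by rewrite /Rintegral integral_indic // setIT.
apply: eq_Rintegral => eta _; rewrite indicE; congr (nat_of_bool _)%:R.
have nthw k : k \in s -> nth None (window (- N%:Z) (N + N) eta) `|(k +
  N%:Z)%R|%N = Some (eta k).
  move=> /sN; rewrite mem_sites => kN.
  rewrite (nth_map 0) ?size_mkseq ?nth_mkseq; try lia.
  by congr (Some (eta _)); lia.
apply/idP/allP; rewrite inE /cylinder /=.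
  by move=> ec k ks; rewrite nthw // ec.
by move=> ec k ks; have := ec k ks; rewrite nthw // => /eqP[].
Qed.

Section pca_dynamics.
Variables (R : realType) (p q : R).
Hypotheses (p_ge0 : 0 <= p) (p_lt1 : p < 1) (q_ge0 : 0 <= q) (q_lt1 : q < 1).
Hypotheses (pq_le1 : p + q <= 1) (pq_gt0 : 0 < p \/ 0 < q).
Implicit Types (mu nu : probability config R) (f : seq (option bool) -> R).

Let A : probability config R -> probability config R := pca p q.

Lemma pca_rate_ge0 a b c : 0 <= pca_rate p q a b c.
Proof. by rewrite /pca_rate; do 2!case: ifP => _; rewrite ?subr_ge0 // ltW. Qed.

Lemma pca_rate_le1 a b c : pca_rate p q a b c <= 1.
Proof.
by rewrite /pca_rate; do 2!case: ifP => _; rewrite ?gerBl // ltW.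
Qed.

(** The candidate cylinder masses are consistent because the rates of the two new states of a site
    add up to 1. *)
Lemma pca_law_exists mu : exists nu, pca_law p q mu nu.
Proof.
pose g (s : seq int) (c : int -> bool) (eta : config) :=
  \prod_(n <- s) pca_rate p q (eta (n - 1)) (eta n) (c n).
have g_ge0 s c eta : 0 <= g s c eta.
  by apply: prodr_ge0 => n _; exact: pca_rate_ge0.
have g_int s c : mu.-integrable setT (EFin \o g s c).
  apply: (@integrable_bounded _ _ _ 1).
    apply: measurable_prod => n _.
    pose f v := pca_rate p q (odflt false (nth None v 0)) (odflt false (nth None
      v 1)) (c n).
    have := measurable_window f (n - 1) 2.
    by congr measurable_fun; apply/funext => eta; rewrite /f !windowS subrK.
  move=> eta; rewrite ger0_norm //; elim: s => [|n s IH];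
    first by rewrite /g big_nil.
  by rewrite /g big_cons mulr_ile1 // ?pca_rate_ge0 ?pca_rate_le1 // g_ge0.
pose M s c := \int[mu]_eta g s c eta.
have [nu nuE] : exists nu : probability config R, forall s c, uniq s ->
    nu (cylinder s c) = (M s c)%:E.
  apply: config_extension => [s c|c|s c c' cc'|s s' c ss'|k s c].
  - by apply: Rintegral_ge0 => eta _; exact: g_ge0.
  - rewrite /M; under eq_Rintegral do rewrite /g big_nil.
    by rewrite Rintegral_probability_cst.
  - apply: eq_Rintegral => eta _; apply: eq_big_seq => n ns.
    by rewrite cc'.
  - by apply: eq_Rintegral => eta _; exact: perm_big.
  - move=> /= /andP[ks us]; rewrite /M -RintegralD //.
    apply: eq_Rintegral => eta _; rewrite /g !big_cons /set_at eqxx.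
    have E b : \prod_(j <- s) pca_rate p q (eta (j - 1)) (eta j) (if j == k then
      b else c j)
      = \prod_(j <- s) pca_rate p q (eta (j - 1)) (eta j) (c j).
      by apply: eq_big_seq => j js; case: eqP js ks => // -> ->.
    rewrite !E -mulrDl -[LHS]mul1r; congr (_ * _).
    by rewrite /pca_rate; case: ifP => _; ring.
exists nu => s c us; rewrite -/(cylinder s c) nuE // /M /Rintegral fineK //.
apply: integrable_fin_num => //; exact: g_int.
Qed.

Lemma pca_lawP mu : pca_law p q mu (A mu).
Proof. exact: (xgetPex mu (pca_law_exists mu)). Qed.

Lemma iter_pca_window t nu f a n :
  \int[iter t A nu]_eta f (window a n eta) =
  \int[nu]_eta iter t (expect p q) f (window (a - t%:Z) (n + t) eta).
Proof.
elim: t f a n => [|t IH] f a n; first by rewrite subr0 addn0.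
rewrite [iter t.+1 A nu]iterS (pca_law_window _ _ _ (pca_lawP _)) IH iterSr.
by rewrite addSnnS; have -> : a - 1 - t%:Z = a - t.+1%:Z by lia.
Qed.

Lemma Rintegral_close nu (g : config -> R) (c b : R) : nu.-integrable setT (EFin
  \o g) ->
  (forall eta, `|g eta - c| <= b) -> `|\int[nu]_eta g eta - c| <= b.
Proof.
move=> ig gb.
have icst d : nu.-integrable setT (EFin \o (fun=> d)) by exact:
  finite_measure_integrable_cst.
have lo : c - b <= \int[nu]_eta g eta.
  rewrite -[leLHS](Rintegral_probability_cst nu);
    apply: le_Rintegral => // eta _.
  by have := gb eta; rewrite ler_norml => /andP[? _]; lra.
have hi : \int[nu]_eta g eta <= c + b.
  rewrite -[leRHS](Rintegral_probability_cst nu);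
    apply: le_Rintegral => // eta _.
  by have := gb eta; rewrite ler_norml => /andP[_ ?]; lra.
by rewrite ler_norml; apply/andP; split; lra.
Qed.

Lemma iter_pca_close t nu f (M : R) a n : (forall w, `|f w| <= M) ->
  `|\int[iter t A nu]_eta f (window a n eta) - unknown_start p q t n f| <=
  2 * M * (n%:R * unknown_density p q t).
Proof.
move=> fM; rewrite iter_pca_window; apply: Rintegral_close.
  exact: integrable_window.
by move=> eta; apply: loss_of_memory => //; rewrite size_window.
Qed.

Lemma unknown_density_cvg0 : unknown_density p q t @[t --> \oo] --> (0 : R).
Proof.
have [K K0 xK] := unknown_density_bound p_ge0 q_ge0 q_lt1 pq_le1 pq_gt0.
apply: (@squeeze_cvgr _ _ _ _ (fun=> 0) (fun t => K * t.+1%:R^-1)).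
- by near=> t; rewrite xK unknown_density_ge0.
- exact: cvg_cst.
- rewrite -[X in _ --> X](mulr0 K); apply: cvgMr; exact: cvg_harmonic.
Unshelve. all: by end_near.
Qed.

Lemma iter_pca_cylinder_close s c : exists2 e : nat -> R, e t @[t --> \oo] -->
  (0 : R) &
  forall t nu nu', `|fine (iter t A nu (cylinder s c)) - fine (iter t A nu'
    (cylinder s c))| <= e t.
Proof.
have [f [a [n [f1 fE]]]] := cylinder_window R s c.
(* Both laws are compared with the unknown start, each at cost 2 for a function bounded by 1. *)
exists (fun t => 4 * n%:R * unknown_density p q t).
  rewrite -[X in _ --> X](mulr0 (4 * n%:R)); apply: cvgMr;
    exact: unknown_density_cvg0.
move=> t nu nu'; rewrite !fE.
have := iter_pca_close t nu a n f1; have := iter_pca_close t nu' a n f1.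
rewrite !ler_norml => /andP[h1 h2] /andP[h3 h4]; apply/andP; split; lra.
Qed.

End pca_dynamics.

(** * Laws determined by their values on cylinders *)

Section laws.
Variable R : realType.
Implicit Types (mu nu : probability config R) (f : seq (option bool) -> R).

(** Cylinders generate the sigma-algebra; together with the empty set, for incompatible
    prescriptions, they are closed under intersection. *)
Lemma same_law_cylinder mu nu :
  (forall s c, uniq s -> mu (cylinder s c) = nu (cylinder s c)) -> same_law mu
    nu.
Proof.
move=> E B mB.
pose G : set (set config) := [set B | B = set0 \/ exists s c, uniq s /\ B =
  cylinder s c].
apply: (measure_unique G (fun=> setT)) => //.
- apply/seteqP; split; apply: smallest_sub; try exact: smallest_sigma_algebra.
    move=> _ [n [b ->]]; apply: sub_sigma_algebra; right.
    exists [:: n], (fun=> b); split=> //; apply/seteqP; split => eta /=.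
      by move=> en k; rewrite inE => /eqP ->.
    by apply; rewrite inE.
  move=> _ [->|[s [c [_ ->]]]]; first exact: measurable0.
  exact: measurable_cylinder.
- move=> B1 B2 [->|[s [c [us ->]]]]; first by move=> _; rewrite set0I; left.
  move=> [->|[s' [c' [us' ->]]]]; first by rewrite setI0; left.
  have [cc'|cc'] := boolP (all (fun k => (k \in s') ==> (c k == c' k)) s);
    last first.
    left; apply/seteqP; split => // eta /= [e e'].
    move/negP: cc'; apply; apply/allP => k ks; apply/implyP => ks'.
    by rewrite -(e k ks) -(e' k ks').
  right; exists (undup (s ++ s')), (fun k => if k \in s then c k else c' k).
  split; first exact: undup_uniq.
  apply/seteqP; split => eta /=.
    move=> [e e'] k; rewrite mem_undup mem_cat; case: ifP => [ks _|_ /=];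
      [exact: e|exact: e'].
  move=> e; split=> k ks.
    by rewrite e ?mem_undup ?mem_cat ?ks.
  rewrite e ?mem_undup ?mem_cat ?ks ?orbT //; case: ifP => // ks1.
  by have /implyP/(_ ks)/eqP := allP cc' k ks1.
- by move=> _; right; exists [::], (fun=> false); split=> //; apply/seteqP;
  split.
- by rewrite bigcup_const //; exists 0%N.
- by move=> _ [->|[s [c [us ->]]]]; [rewrite !measure0|exact: E].
- by move=> _; apply: (le_lt_trans (probability_le1 mu measurableT));
  rewrite ltry.
Qed.

Lemma fine_probability_inj mu nu (B C : set config) : measurable B -> measurable
  C ->
  fine (mu B) = fine (nu C) -> mu B = nu C.
Proof.
move=> mB mC E.
by rewrite -(fineK (fin_num_measure mu _ mB)) E (fineK (fin_num_measure nu _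
  mC)).
Qed.

Lemma cvg_Rintegral_window (nu_ : nat -> probability config R) mu f a n :
  (forall s c, uniq s ->
    fine (nu_ t (cylinder s c)) @[t --> \oo] --> fine (mu (cylinder s c))) ->
  \int[nu_ t]_eta f (window a n eta) @[t --> \oo] --> \int[mu]_eta f (window a n
    eta).
Proof.
move=> cyl_cvg; rewrite Rintegral_window; under eq_fun do rewrite
  Rintegral_window.
have word_cvg w : size w = n -> fine (nu_ t [set eta | window a n eta = w]) @[t
  --> \oo] -->
    fine (mu [set eta | window a n eta = w]).
  move=> wn; have [wN|wN] := boolP (None \in w).
    rewrite (_ : [set eta | window a n eta = w] = set0); last first.
      apply/seteqP; split => // eta /= ew.
      by have := window_known a n eta; rewrite ew wN.
    by under eq_fun do rewrite measure0; rewrite measure0; exact: cvg_cst.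
  rewrite (known_word wN) -wn; set w' := map (odflt false) w.
  have -> : size w = size w' by rewrite /w' size_map.
  rewrite (_ : [set eta | window a (size w') eta = map Some w'] =
    cylinder (sites a (size w')) (fun k => nth false w' `|k - a|%N)).
    exact/cyl_cvg/sites_uniq.
  by apply/seteqP; split => eta /=; move/window_eqP.
have sum_cvg m (F : nat -> seq (option bool) -> R) G :
    (forall w, size w = m -> F t w @[t --> \oo] --> G w) ->
    word_sum m (F t) @[t --> \oo] --> word_sum m G.
  elim: m F G => [|m IH] F G FG /=; first exact: FG.
  apply: cvgD; first apply: cvgD; apply: (IH (fun t w => F t (_ :: w))) => w wm;
    by apply: FG; rewrite /= wm.
apply: sum_cvg => w wn; apply: cvgMr; exact: word_cvg.
Qed.

End laws.

(** * From convergence on cylinders to weak convergence *)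

Section weak_convergence.
Variable R : realType.

Lemma config_compact : compact [set: config].
Proof.
have := @tychonoff _ (fun _ : int => _) _ (fun=> bool_compact).
by congr (compact _); rewrite eqEsubset.
Qed.

Definition truncate (N : nat) (eta : config) : config :=
  fun k => (`|k| < N)%N && eta k.

(** Convergence is joint in the configuration and the cut-off, so that compactness can make the
    cut-off uniform. *)
Lemma truncate_cvg (eta : config) :
  (fun z : config * nat => truncate z.2 z.1) @ (nbhs eta, \oo) --> eta.
Proof.
apply/cvg_sup => k U [V] [[W] oW <-] Wk WU.
have near_k : nbhs eta [set e : config | e k = eta k].
  apply: (@proj_continuous int (fun=> bool) k eta [set eta k]).
  exact: discrete_set1.
have near_N : \forall N \near \oo, (`|k| < N)%N by exact: nbhs_infty_gt.
exists ([set e : config | e k = eta k], [set N | (`|k| < N)%N]) =>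
  //= -[e N] [/= ek kN].
by apply: WU => /=; rewrite /truncate kN ek.
Qed.

Lemma truncate_uniform (f : config -> R) (e : R) : continuous f -> 0 < e ->
  exists N, forall eta, `|f eta - f (truncate N eta)| <= e.
Proof.
move=> cf e0.
have /compact_near_coveringP/(_ _ \oo (fun N eta => `|f eta - f (truncate N
  eta)| <= e) _) :=
  config_compact.
case.
- move=> eta _.
  have e20 : 0 < e / 2 by rewrite divr_gt0.
  have h1 : \forall z \near (nbhs eta, \oo), `|f eta - f (truncate z.2 z.1)| < e
    / 2.
    have := cvg_comp _ _ (truncate_cvg (eta := eta)) (cf eta).
    by move=> /cvgrPdist_lt; exact.
  have h2 : \forall z \near (nbhs eta, \oo), `|f eta - f z.1| < e / 2.
    have near_eta : \forall eta' \near eta, `|f eta - f eta'| < e / 2.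
      by have /cvgrPdist_lt := cf eta; exact.
    exists ([set eta' | `|f eta - f eta'| < e / 2], setT); last by move=> z [].
    by split=> //; exact: filterT.
  apply: filterS2 h1 h2 => z /= z1 z2.
  have -> : f z.1 - f (truncate z.2 z.1) = (f eta - f (truncate z.2 z.1)) - (f
    eta - f z.1) by ring.
  apply: (le_trans (ler_normB _ _)); lra.
- move=> N _ /(_ N (leqnn N)) NH; exists N => eta; exact: NH.
Qed.

Lemma truncate_window (f : config -> R) (M : R) N : (forall eta, `|f eta| <= M)
  ->
  exists f', (forall w, `|f' w| <= M) /\ forall eta,
    f (truncate N eta) = f' (window (- N%:Z) (N + N) eta).
Proof.
move=> fM.
pose c (w : seq (option bool)) : config := fun k =>
  (`|k| < N)%N && odflt false (nth None w `|(k + N%:Z)%R|%N).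
exists (fun w => f (c w)); split=> [w|eta]; first exact: fM.
congr f; apply/funext => k; rewrite /truncate /c; case: ltnP => //= kN.
by rewrite (nth_map 0) ?size_mkseq ?nth_mkseq; [congr (eta _)|..]; lia.
Qed.

(** The sigma-algebra is generated by coordinates rather than by open sets, so f is written as a
    limit of functions of finite windows. *)
Lemma continuous_measurable_config (f : config -> R) : continuous f ->
  (exists M : R, forall eta, `|f eta| <= M) -> measurable_fun setT f.
Proof.
move=> cf [M fM].
have ex n : exists N, forall eta, `|f eta - f (truncate N eta)| <= n.+1%:R^-1.
  by apply: truncate_uniform => //; rewrite invr_gt0 ltr0n.
have [N_ N_P] := choice ex.
apply: (@measurable_fun_cvg _ _ _ _ (fun n eta => f (truncate (N_ n) eta))) =>
  [n|eta _].
  have [f' [_ f'E]] := truncate_window (N_ n) fM.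
  under eq_fun do rewrite f'E; exact: measurable_window.
apply/cvgrPdist_le => e e0; near=> n; apply: (le_trans (N_P n eta)).
apply: ltW; near: n; exact: (near_infty_natSinv_lt (PosNum e0)).
Unshelve. all: by end_near.
Qed.

Lemma weakly_converges_cylinder (nu_ : nat -> probability config R)
    (mu : probability config R) :
  (forall s c, uniq s ->
    fine (nu_ t (cylinder s c)) @[t --> \oo] --> fine (mu (cylinder s c))) ->
  weakly_converges nu_ mu.
Proof.
move=> cyl_cvg f cf [M fM].
have mf := continuous_measurable_config cf (ex_intro _ M fM).
have intf (nu : probability config R) : nu.-integrable setT (EFin \o f) by
  exact: integrable_bounded mf fM.
rewrite -[X in _ --> X]fineK; last exact: integrable_fin_num (intf mu).
apply/fine_cvgP; split.
  by apply: nearW => t; exact: integrable_fin_num (intf (nu_ t)).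
apply/cvgrPdist_le => e e0.
have e30 : 0 < e / 3 by rewrite divr_gt0.
have [N Nf] := truncate_uniform cf e30.
have [f' [f'M f'E]] := truncate_window N fM.
have close (nu : probability config R) : `|\int[nu]_eta f eta - \int[nu]_eta f'
  (window (- N%:Z) (N + N) eta)| <= e / 3.
  rewrite -(RintegralB measurableT (intf nu) (integrable_window nu f' (- N%:Z)
    (N + N))).
  rewrite -[X in `|X|]subr0; apply: Rintegral_close => [|eta].
    have := integrableB measurableT (intf nu) (integrable_window nu f' (- N%:Z)
      (N + N)).
    by [].
  by rewrite subr0 -f'E.
have := @cvg_Rintegral_window _ nu_ mu f' (- N%:Z) (N + N) cyl_cvg.
move=> /cvgrPdist_le/(_ _ e30) near_window.
near=> t.
have h : `|\int[mu]_eta f' (window (- N%:Z) (N + N) eta) -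
    \int[nu_ t]_eta f' (window (- N%:Z) (N + N) eta)| <= e / 3.
  by near: t; exact: near_window.
have h1 := close mu; have h2 := close (nu_ t).
move: h h1 h2; rewrite !ler_norml.
set x := \int[mu]_eta f eta; set y := \int[nu_ t]_eta f eta.
rewrite -[fine _]/x /= -[fine _]/y.
by move=> /andP[? ?] /andP[? ?] /andP[? ?]; apply/andP; split; lra.
Unshelve. all: by end_near.
Qed.

End weak_convergence.

(** * Ergodicity *)

Section ergodicity.
Variables (R : realType) (p q : R).
Hypotheses (p_ge0 : 0 <= p) (p_lt1 : p < 1) (q_ge0 : 0 <= q) (q_lt1 : q < 1).
Hypotheses (pq_le1 : p + q <= 1) (pq_gt0 : 0 < p \/ 0 < q).
Implicit Types (mu nu : probability config R).

Let A : probability config R -> probability config R := pca p q.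

Let pcaP mu : pca_law p q mu (A mu).
Proof. exact: pca_lawP. Qed.

(** The bound [e t] holds for any two initial laws. Applied to [nu0] and one of its iterates it
    gives a Cauchy sequence; applied to [nu0] and [nu] it makes the limit independent of [nu]. *)
Lemma iter_pca_cylinder_cvg s c : exists l : R,
  forall nu, fine (iter t A nu (cylinder s c)) @[t --> \oo] --> l.
Proof.
have [e e0 eP] := iter_pca_cylinder_close p_ge0 p_lt1 q_ge0 q_lt1 pq_le1 pq_gt0
  s c.
pose nu0 : probability config R := \d_((fun=> false) : config).
pose u t := fine (iter t A nu0 (cylinder s c)).
have cu : cvg (u @ \oo).
  apply/cauchy_cvgP/cauchy_exP => eps eps0.
  have /cvgrPdist_lt/(_ _ eps0)[t _ /(_ t (leqnn t))] := e0.
  rewrite sub0r normrN => /= et; exists (u t); exists t => // n /= tn.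
  rewrite /ball /= /u -(subnKC tn) iterD.
  exact: le_lt_trans (eP _ _ _) (le_lt_trans (ler_norm _) et).
exists (lim (u @ \oo)) => nu; apply/cvgrPdist_le => eps eps0.
have eps20 : 0 < eps / 2 by rewrite divr_gt0.
near=> t.
have h1 : `|lim (u @ \oo) - u t| <= eps / 2.
  near: t; move: cu => /cvgrPdist_le; exact.
have h2 : `|0 - e t| <= eps / 2 by near: t; move: e0 => /cvgrPdist_le; exact.
have h3 := eP t nu0 nu; move: h1 h2 h3; rewrite sub0r normrN /u.
rewrite !ler_norml => /andP[? ?] /andP[? ?] /andP[? ?]; apply/andP; split; lra.
Unshelve. all: by end_near.
Qed.

Lemma limit_law : exists mu, forall nu s c, uniq s ->
  fine (iter t A nu (cylinder s c)) @[t --> \oo] --> fine (mu (cylinder s c)).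
Proof.
have [l0 l0P] := choice
  (fun z : seq int * (int -> bool) => iter_pca_cylinder_cvg z.1 z.2).
pose l s c := l0 (s, c).
have lP s c nu : fine (iter t A nu (cylinder s c)) @[t --> \oo] --> l s c.
  exact: (l0P (s, c)).
pose nu0 : probability config R := \d_((fun=> false) : config).
have fin (nu : probability config R) s c : nu (cylinder s c) \is a fin_num.
  by apply: fin_num_measure; exact: measurable_cylinder.
(* The limit depends on the cylinder as a set only, which gives the congruence and permutation
   conditions of the extension. *)
have l_eq s c s' c' : cylinder s c = cylinder s' c' -> l s c = l s' c'.
  by move=> E; apply: cvg_unique (lP s c nu0) _ => //; rewrite E; exact: lP.
have [mu muE] : exists mu : probability config R, forall s c, uniq s ->
    mu (cylinder s c) = (l s c)%:E.
  apply: config_extension => [s c|c|s c c' cc'|s s' c ss'|k s c].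
  - apply: cvgr_to_ge (lP s c nu0) _; apply: nearW => t.
    exact/fine_ge0/measure_ge0.
  - apply: cvg_unique (lP [::] c nu0) _ => //.
    rewrite (_ : cylinder [::] c = setT); last by apply/seteqP; split.
    rewrite (_ : (fun t => _) = fun=> 1); first exact: cvg_cst.
    by apply/funext => t; exact: (congr1 fine (probability_setT (iter t A
      nu0))).
  - by apply: l_eq; apply/seteqP; split => eta /= e n ns; rewrite (e n ns) cc'.
  - by apply: l_eq; apply/seteqP; split => eta /= e n ns; apply: e;
    rewrite ?(perm_mem ss') // -(perm_mem ss').
  - move=> uks; have /= /andP[ks us] := uks.
    apply: cvg_unique (lP s c nu0) _ => //.
    have sum_cvg := cvgD (lP (k :: s) (set_at c k false) nu0) (lP (k :: s)
      (set_at c k true) nu0).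
    rewrite (_ : (fun t => _) = (fun t =>
      fine (iter t A nu0 (cylinder (k :: s) (set_at c k false))) +
      fine (iter t A nu0 (cylinder (k :: s) (set_at c k true))))).
      exact: sum_cvg.
    apply/funext => t.
    by rewrite (cylinder_split _ _ ks) fineD.
by exists mu => nu s c us; rewrite muE.
Qed.

Lemma pca_ergodic : ergodic A.
Proof.
have [mu muP] := limit_law.
exists mu; split.
- apply: same_law_cylinder => s c us.
  apply: fine_probability_inj; try exact: measurable_cylinder.
  have [f [a [n [_ fE]]]] := cylinder_window R s c.
  rewrite fE (pca_law_window _ _ _ (pcaP mu)).
  (* One sequence, two limits: the last step taken as a dual function integrated against the
     iterates, and the shifted sequence itself. *)
  apply: (@cvg_unique _ _ (fine (iter t.+1 A mu (cylinder s c)) @[t --> \oo]))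
    => //.
    rewrite (_ : (fun t => _) = (fun t =>
      \int[iter t A mu]_eta expect p q f (window (a - 1) n.+1 eta)));
        last first.
      by apply/funext => t; rewrite fE [iter _.+1 _ _]iterS (pca_law_window _ _
        _ (pcaP _)).
    by apply: cvg_Rintegral_window => s' c' us'; exact: muP.
  by have := muP mu s c us; rewrite -(cvg_shiftS (fun t =>
    fine (iter t A mu (cylinder s c)))).
- move=> nu nu_st; apply: same_law_cylinder => s c us.
  (* Stationarity is equality on measurable sets only, so one step must be shown to respect
     [same_law] before iterating. *)
  have iter_nu t : same_law (iter t A nu) nu.
    elim: t => [//|t IH]; apply: same_law_cylinder => s' c' us'.
    rewrite iterS (pcaP _ _ us').
    rewrite (eq_measure_integral nu); last by move=> B mB _; exact: IH.
    by rewrite -(pcaP nu) // nu_st //; exact: measurable_cylinder.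
  apply: fine_probability_inj; try exact: measurable_cylinder.
  have := muP nu s c us.
  under eq_fun do rewrite (iter_nu _ _ (measurable_cylinder s c)).
  by move=> h; apply: cvg_unique h => //; exact: cvg_cst.
- by move=> nu; apply: weakly_converges_cylinder => s c us; exact: muP.
Qed.

End ergodicity.

(** * The percolation game *)

Section game.
Variable w : vertex -> site.

Definition right_of (x : vertex) : vertex := (x.1 + 1, x.2).
Definition above (x : vertex) : vertex := (x.1, x.2 + 1).

(** Backward induction cut at depth t. The upper neighbour comes first to agree with the order of
    inputs along [antidiagonal]. *)
Fixpoint outcome t (x : vertex) : option bool :=
  if t is t'.+1 then update (w x) (outcome t' (above x)) (outcome t' (right_of
    x))
  else None.

Lemma update_mono c a b a' b' d : (a = None \/ a = a') -> (b = None \/ b = b')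
  ->
  update c a b = Some d -> update c a' b' = Some d.
Proof. by case: c a b a' b' d => [] [[]|] [[]|] [[]|] [[]|] [] [] // ? [] // ?.
  Qed.

Lemma outcome_mono t t' x b : (t <= t')%N -> outcome t x = Some b ->
  outcome t' x = Some b.
Proof.
elim: t t' x b => [//|t IH] [//|t'] x b tt' /=.
by apply: update_mono; [case E: (outcome t (above x)) =>
  [d|]|case E: (outcome t (right_of x)) => [d|]];
  auto; right; rewrite (IH _ _ _ tt' E).
Qed.

Lemma outcome_not_open x b : w x = (if b then Target else Trap) ->
  outcome 1 x = Some b.
Proof. by rewrite /= => ->; case: b. Qed.

Lemma outcome_open t x b : w x = Open -> outcome t.+1 x = Some b ->
  if b then outcome t (above x) = Some false /\ outcome t (right_of x) = Some
    false
  else exists2 y, legal_move x y & outcome t y = Some true.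
Proof.
rewrite /= => ->; case Ea: (outcome t (above x)) => [[]|];
  case Er: (outcome t (right_of x)) => [[]|];
  case: b => //= _; by [exists (above x); [right|]|exists (right_of x);
    [left|]].
Qed.

(** A strategy sees only the vertex and not the depth, so one move has to serve all depths. *)
Definition winning_move (x : vertex) : vertex :=
  xget (above x) [set y | legal_move x y /\
    forall t, outcome t.+1 x = Some false -> outcome t y = Some true].

Lemma winning_move_legal : strategy winning_move.
Proof.
move=> x; rewrite /winning_move; case: xgetP => [y -> [] //|_]; by right.
Qed.

(** A move that works at the least deciding depth works at all larger ones, since decided outcomes
    persist. *)
Lemma winning_moveP t x : w x = Open -> outcome t.+1 x = Some false ->
  outcome t (winning_move x) = Some true.
Proof.
move=> xO xt.
pose good : set vertex := [set y | legal_move x y /\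
    forall t, outcome t.+1 x = Some false -> outcome t y = Some true].
suff [y yP] : exists y, good y.
  by have [_] := @xgetPex _ (above x) good (ex_intro _ y yP); apply.
have ex : exists t, outcome t.+1 x == Some false by exists t; apply/eqP.
case: (ex_minnP ex) => m /eqP xm min_m.
have [y xy ym] := outcome_open xO xm.
exists y; split=> // t' xt'; apply: outcome_mono ym.
exact/min_m/eqP.
Qed.

(* The player considered is the first one if b is false, the second one if b is
   true; likewise in safe_never_loses. *)
Lemma forced_win (b : bool) s1 s2 x k :
  strategy s1 -> strategy s2 -> (if b then s2 else s1) = winning_move ->
  outcome k x = Some b ->
  exists n, (forall j, (j < n)%N -> w (token s1 s2 x j) = Open) /\
    w (token s1 s2 x n) = if odd n (+) b then Target else Trap.
Proof.
move=> st1 st2 sb xb.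
(* Induction on the remaining depth k after n moves; outcomes are relative to the player to move,
   hence the flip in [odd n (+) b]. *)
suff: forall k n, (forall j, (j < n)%N -> w (token s1 s2 x j) = Open) ->
    outcome k (token s1 s2 x n) = Some (odd n (+) b) ->
    exists n, (forall j, (j < n)%N -> w (token s1 s2 x j) = Open) /\
    w (token s1 s2 x n) = if odd n (+) b then Target else Trap.
  by move=> /(_ k 0%N); apply.
elim=> [//|{xb}{}k IH] n opn outn.
case wn: (w (token s1 s2 x n)).
- by exists n; split=> //; move: outn; rewrite /= wn => -[<-].
- by exists n; split=> //; move: outn; rewrite /= wn => -[<-].
apply: (IH n.+1) => [j|].
  by rewrite ltnS leq_eqVlt => /predU1P[->|/opn].
have := outcome_open wn outn; set y := token s1 s2 x n.
rewrite [token _ _ _ _]/= -/y.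
case ob : (odd n (+) b) => /=.
  have -> : ~~ odd n (+) b = false by rewrite addNb ob.
  by move=> [ya yr]; case: ifP => _; [case: (st2 y)|case: (st1 y)] => ->.
move=> _; have -> : ~~ odd n (+) b = true by rewrite addNb ob.
have -> : (if odd n then s2 y else s1 y) = winning_move y.
  by move: sb ob; case: (b) (odd n) => [] [] //= ->.
by apply: winning_moveP => //; rewrite outn ob.
Qed.

Definition safe_move (x : vertex) : vertex :=
  xget (above x) [set y | legal_move x y /\ forall t, outcome t y <> Some
    false].

Lemma safe_move_legal : strategy safe_move.
Proof.
by move=> x; rewrite /safe_move; case: xgetP => [y -> [] //|_]; right.
Qed.

(** If both moves gave the opponent a win, each at a finite depth, x would be lost one level beyond
    the larger depth. *)
Lemma safe_moveP x : w x = Open -> (forall t, outcome t x <> Some true) ->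
  forall t, outcome t (safe_move x) <> Some false.
Proof.
move=> xO xN.
pose good : set vertex := [set y | legal_move x y /\ forall t, outcome t y <>
  Some false].
suff [y yP] : exists y, good y.
  by have [_] := @xgetPex _ (above x) good (ex_intro _ y yP); apply.
apply: contrapT => no_good.
have bad y : legal_move x y -> exists t, outcome t y = Some false.
  move=> xy; apply: contrapT => yN; apply: no_good; exists y; split=> // t yt.
  by apply: yN; exists t.
have [t1 at1] := bad (above x) (or_intror erefl).
have [t2 rt2] := bad (right_of x) (or_introl erefl).
apply: (xN (maxn t1 t2).+1).
by rewrite /= xO (outcome_mono (leq_maxl _ _) at1) (outcome_mono (leq_maxr _ _)
  rt2).
Qed.

Lemma safe_never_loses (b : bool) s1 s2 x :
  strategy s1 -> strategy s2 -> (if b then s2 else s1) = safe_move ->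
  (forall t, outcome t x <> Some (~~ b)) ->
  ~ exists n, (forall j, (j < n)%N -> w (token s1 s2 x j) = Open) /\
    w (token s1 s2 x n) = if odd n (+) ~~ b then Target else Trap.
Proof.
move=> st1 st2 sb xN [N [opN wN]].
(* Invariant: no depth decides the position for the opponent of the safe player. [safe_moveP] keeps
   it on the safe player's turn; on the other turn, a move breaking it would have decided the
   position before the move. *)
have inv n : (n <= N)%N -> forall t, outcome t (token s1 s2 x n) <> Some (odd n
  (+) ~~ b).
  elim: n => [//|n IH] nN; have {}IH := IH (ltnW nN).
  have wn := opN n nN; rewrite [token _ _ _ _]/=; move: wn IH;
    set y := token s1 s2 x n.
  move=> wn IH; rewrite [odd _]/= addNb; case ob : (odd n (+) ~~ b) IH => IH.
    have -> : (if odd n then s2 y else s1 y) = safe_move y.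
      by move: sb ob; case: (b) (odd n) => [] [] //= ->.
    exact: safe_moveP.
  move=> t nt; apply: (IH t.+1).
  have : legal_move y (if odd n then s2 y else s1 y) by case: ifP.
  rewrite /= wn; move: nt; move: (if odd n then s2 y else s1 y) => z zt [zy|zy].
    have -> : outcome t (right_of y) = Some true by rewrite -zt zy.
    by case: (outcome t (above y)) => [[]|].
  by have -> : outcome t (above y) = Some true by rewrite -zt zy.
exact: (inv N (leqnn N) 1%N (outcome_not_open wN)).
Qed.

Lemma draw_outcome : draw w <-> forall t, outcome t (0, 0) = None.
Proof.
split=> [[no1 no2] t|undecided].
  case ot: (outcome t (0, 0)) => [[]|] //.
    exfalso; apply: no2; exists winning_move; first exact: winning_move_legal.
    move=> s1 st1; have [n [opn wn]] :=
      forced_win (b := true) st1 winning_move_legal erefl ot.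
    by exists n; split=> //; rewrite wn addbT; case: (odd n).
  exfalso; apply: no1; exists winning_move; first exact: winning_move_legal.
  move=> s2 st2; have [n [opn wn]] :=
    forced_win (b := false) winning_move_legal st2 erefl ot.
  by exists n; split=> //; rewrite wn addbF.
split=> -[s st win].
  have [n [opn wn]] := win _ safe_move_legal.
  apply: (@safe_never_loses true _ _ (0, 0) st safe_move_legal erefl).
    by move=> t; rewrite undecided.
  by exists n; rewrite addbF.
have [n [opn wn]] := win _ safe_move_legal.
apply: (@safe_never_loses false _ _ (0, 0) safe_move_legal st erefl).
  by move=> t; rewrite undecided.
by exists n; rewrite addbT; split=> //; rewrite wn; case: (odd n).
Qed.

(* The moves from the k-th vertex of the d-th antidiagonal lead to the vertices
   k and k + 1 of the next one, as for the inputs of the automaton. *)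
Definition antidiagonal d : seq vertex :=
  mkseq (fun k => (k%:Z, d%:Z - k%:Z)) d.+1.

Lemma outcome_step t d : map (outcome t.+1) (antidiagonal d) =
  step (map w (antidiagonal d)) (map (outcome t) (antidiagonal d.+1)).
Proof.
have nth_step l v i : (i < size l)%N -> (i.+1 < size v)%N ->
    nth None (step l v) i = update (nth Open l i) (nth None v i) (nth None v
      i.+1).
  elim: l v i => [//|c l IH] [//|a [//|b v]] [|i] //= il iv.
  by rewrite IH.
apply: (@eq_from_nth _ None); first by rewrite size_step !size_map !size_iota
  minnn.
move=> i; rewrite size_map size_mkseq => id.
rewrite nth_step; try by rewrite !size_map size_iota.
rewrite !(nth_map (0, 0)) ?size_mkseq ?nth_mkseq //; try exact: ltnW.
rewrite /= /above /right_of /=; congr (update _ (outcome t (_, _)) (outcome t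
  (_, _))); lia.
Qed.

(** Automaton time runs inwards, from far antidiagonals to the origin, with fresh labels at each
    step. *)
Fixpoint evolve d (v : seq (option bool)) : seq (option bool) :=
  if d is d'.+1 then evolve d' (step (map w (antidiagonal d')) v) else v.

Lemma evolve_outcome d t :
  evolve d (map (outcome t) (antidiagonal d)) = [:: outcome (t + d) (0, 0)].
Proof.
elim: d t => [|d IH] t; first by rewrite addn0 /= subr0.
rewrite -[LHS]/(evolve d (step (map w (antidiagonal d)) (map (outcome t)
  (antidiagonal d.+1)))).
by rewrite -outcome_step IH addSnnS.
Qed.

Lemma evolve_unknown d : evolve d (nseq d.+1 None) = [:: outcome d (0, 0)].
Proof.
rewrite -[d in RHS]add0n -evolve_outcome; congr evolve.
have map_const (s : seq vertex) : map (outcome 0) s = nseq (size s) None.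
  by elim: s => //= x s ->.
by rewrite map_const size_mkseq.
Qed.

End game.

(** * The game on random labels *)

Section random_game.
Variables (R : realType) (p q : R) (d : measure_display) (Omega : measurableType
  d).
Variables (P : probability Omega R) (X : vertex -> Omega -> site).
Hypothesis X_field : percolation_field p q P X.

Let mX x c : measurable [set o | X x o = c]. Proof. exact: (field_measurable
  X_field). Qed.

Lemma measurable_site_cases (x : vertex) (E : site -> set Omega) :
  (forall c, measurable (E c)) -> measurable [set o | E (X x o) o].
Proof.
move=> mE; rewrite [X in measurable X](_ : _ = ([set o | X x o = Trap] `&` E
  Trap) `|`
   (([set o | X x o = Target] `&` E Target) `|` ([set o | X x o = Open] `&` E
     Open))).
  by apply: measurableU; [|apply: measurableU]; apply: measurableI.
apply/seteqP; split => o /=.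
  by case xo: (X x o) => Eo; [left|right;left|right;right].
by case=> [|[|]] [->].
Qed.

Lemma measurable_labels (s : seq vertex) (K : seq site -> set Omega) :
  (forall l, measurable (K l)) -> measurable [set o | K (map (X^~ o) s) o].
Proof.
elim: s K => [|x s IH] K mK /=; first exact: mK.
apply: (@measurable_site_cases x (fun c => [set o | K (c :: map (X^~ o) s) o]))
  => c.
exact: (IH (fun l => K (c :: l)) (fun l => mK (c :: l))).
Qed.

Lemma measurable_outcome t x b : measurable [set o | outcome (X^~ o) t x = b].
Proof.
elim: t x b => [|t IH] x b /=.
  case: b => [b|].
    by rewrite [X in measurable X](_ : _ = set0) //; apply/seteqP; split.
  by rewrite [X in measurable X](_ : _ = setT) //; apply/seteqP; split.
apply: (@measurable_site_cases x (fun c => [set o |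
  update c (outcome (X^~ o) t (above x)) (outcome (X^~ o) t (right_of x)) = b]))
    => c.
rewrite [X in measurable X](_ : _ = \bigcup_(z : option bool * option bool)
  (if update c z.1 z.2 == b then [set o | outcome (X^~ o) t (above x) = z.1] `&`
     [set o | outcome (X^~ o) t (right_of x) = z.2] else set0)).
  apply: (countable_bigcupT_measurable (countableP _)) => z.
  by case: ifP => // _; apply: measurableI; exact: IH.
apply/seteqP; split => o /=.
  move=> ub; exists (outcome (X^~ o) t (above x), outcome (X^~ o) t (right_of
    x)) => //=.
  by rewrite ub eqxx.
by case=> z _; case: eqP => // <- [-> ->].
Qed.

Lemma measurable_evolve D v (B : pred (seq (option bool))) :
  measurable [set o | B (evolve (X^~ o) D v)].
Proof.
elim: D v => [|D IH] v /=.
  case: (B v); first by rewrite [X in measurable X](_ : _ = setT) //;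
    apply/seteqP; split.
  by rewrite [X in measurable X](_ : _ = set0) //; apply/seteqP; split.
exact: (@measurable_labels (antidiagonal D)
  (fun l => [set o | B (evolve (X^~ o) D (step l v))])).
Qed.

Definition label_event (s : seq vertex) (c : vertex -> site) : set Omega :=
  [set o | forall x, x \in s -> X x o = c x].

Definition label_weight (s : seq vertex) (c : vertex -> site) : R :=
  \prod_(x <- s) site_prob p q (c x).

Lemma label_event_prob s c : uniq s -> P (label_event s c) = (label_weight s
  c)%:E.
Proof.
move=> us; rewrite /label_event (field_independent X_field (fun x =>
  [set c x]) us).
rewrite /label_weight; elim: s {us} => [|x s IH]; first by rewrite !big_nil.
by rewrite !big_cons IH (field_law X_field) -EFinM.
Qed.

Lemma measurable_label_event s c : measurable (label_event s c).
Proof.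
elim: s => [|x s IH].
  by rewrite [X in measurable X](_ : _ = setT) //; apply/seteqP; split.
rewrite [X in measurable X](_ : _ = [set o | X x o = c x] `&` label_event s c).
  exact: measurableI.
apply/seteqP; split => o /=.
  by move=> oc; split=> [|y ys]; apply: oc; rewrite inE ?eqxx // ys orbT.
by move=> [xo oc] y; rewrite inE => /predU1P[->|/oc].
Qed.

Definition label_at (c : vertex -> site) x a : vertex -> site :=
  fun y => if y == x then a else c y.

Lemma prob_site_cases (x : vertex) (E : set Omega) : measurable E ->
  P E = (P (E `&` [set o | X x o = Trap]) + P (E `&` [set o | X x o = Target])
    + P (E `&` [set o | X x o = Open]))%E.
Proof.
move=> mE; have mEc c : measurable (E `&` [set o | X x o = c]) by exact:
  measurableI.
rewrite -measureU //; last first.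
  by apply/seteqP; split => // o /= [[_ ->] []].
rewrite -measureU //; last first.
- by apply/seteqP; split => // o /= [[[_ ->]|[_ ->]] []].
- exact: measurableU.
congr (P _); apply/seteqP; split => o /=.
  by case: (X x o) => Eo; [left;left|left;right|right].
by case=> [[|]|] [].
Qed.

(* If K depends only on labels independent of those in rho ++ s, then P averages
   K over the labels in rho; the product hypothesis replaces independence. *)
Lemma condition_on_labels (rho s : seq vertex) c (K : seq site -> set Omega)
    (g : seq site -> R) :
  (forall l, measurable (K l)) -> uniq (rho ++ s) ->
  (forall c', (forall x, x \in s -> c' x = c x) ->
    P (label_event (rho ++ s) c' `&` K (map c' rho)) =
    (label_weight (rho ++ s) c' * g (map c' rho))%:E) ->
  P (label_event s c `&` [set o | K (map (X^~ o) rho) o]) =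
  (label_weight s c * mean p q (size rho) g)%:E.
Proof.
elim: rho s c K g => [|x rho IH] s c K g mK us KE; first exact: KE.
have mK' : measurable (label_event s c `&` [set o | K (map (X^~ o) (x :: rho))
  o]).
  by apply: measurableI; [exact: measurable_label_event|exact:
    measurable_labels].
have xs : x \notin s.
  by move: us; rewrite /= mem_cat negb_or => /andP[/andP[]].
have perm_rho : perm_eq (rho ++ x :: s) (x :: rho ++ s).
  by rewrite -cat1s perm_catCA.
(* Revealing the label of x moves it from [rho] to [s], where the induction hypothesis takes it as
   given. *)
have case_x a : P (label_event s c `&` [set o | K (map (X^~ o) (x :: rho)) o]
     `&` [set o | X x o = a]) =
   (site_prob p q a * label_weight s c * mean p q (size rho) (fun l =>
     g (a :: l)))%:E.
  have ca y : y \in s -> label_at c x a y = c y.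
    by move=> ys; rewrite /label_at; case: eqP ys xs => // -> ->.
  have -> : site_prob p q a * label_weight s c = label_weight (x :: s) (label_at
    c x a).
    rewrite /label_weight big_cons /label_at eqxx; congr (_ * _).
    by apply: eq_big_seq => y ys; rewrite -{1}(ca y ys).
  rewrite -(IH _ _ (fun l => K (a :: l))) //; last first.
  - move=> c' c'x.
    have c'xa : c' x = a by rewrite c'x ?mem_head // /label_at eqxx.
    rewrite /label_weight (perm_big _ perm_rho) /= -/(label_weight _ _).
    rewrite -c'xa -[c' x :: _]/(map c' (x :: rho)) -KE; last first.
      by move=> y ys; rewrite c'x ?inE ?ys ?orbT // ca.
    congr (P (_ `&` _)); apply/seteqP; split => o /= oc y ys; apply: oc;
      by rewrite ?(perm_mem perm_rho) // -(perm_mem perm_rho).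
  - by rewrite (perm_uniq perm_rho).
  congr (P _); apply/seteqP; split => o /=.
    move=> [[oc oK] ox]; split; last by rewrite -ox.
    move=> y; rewrite inE => /predU1P[->|ys]; first by rewrite /label_at eqxx.
    by rewrite ca // oc.
  move=> [oc oK]; have ox : X x o = a by rewrite oc ?mem_head // /label_at eqxx.
  split=> //; split; last by rewrite ox.
  by move=> y ys; rewrite oc ?ca // inE ys orbT.
rewrite (prob_site_cases x mK') !case_x -!EFinD; congr (_%:E).
by rewrite /=; ring.
Qed.

(** The event on s carries along the labels already revealed. [evolve] reads only antidiagonals
    below D, which are disjoint from s. *)
Lemma evolve_prob D v (B : pred (seq (option bool))) s c : size v = D.+1 -> uniq
  s ->
  (forall x, x \in s -> D%:Z <= x.1 + x.2) ->
  P (label_event s c `&` [set o | B (evolve (X^~ o) D v)]) =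
  (label_weight s c * iter D (expect p q) (fun u => (B u)%:R) v)%:E.
Proof.
elim: D v s c => [|D IH] v s c vD us sD.
  rewrite /=; case: (B v); first by rewrite mulr1 -label_event_prob // (_ : [set
    o | true] = setT) ?setIT //;
    apply/seteqP; split.
  by rewrite mulr0 (_ : [set o | false] = set0) ?setI0 ?measure0 //;
    apply/seteqP; split.
have sizeD : size (antidiagonal D) = D.+1 by rewrite size_mkseq.
have mem_anti x : x \in antidiagonal D -> x.1 + x.2 = D%:Z.
  by move=> /mapP[k _ ->] /=; lia.
have us_anti : uniq (antidiagonal D ++ s).
  rewrite cat_uniq us andbT; apply/andP; split.
    by rewrite mkseq_uniq // => i j [] /=; lia.
  apply/hasPn => x /sD xD; apply/negP => /mem_anti xa.
  by move: xD; rewrite xa; lia.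
rewrite iterS [X in _ * X]/expect vD -[D.+2.-1]sizeD.
apply: (@condition_on_labels _ _ _ (fun l => [set o | B (evolve (X^~ o) D (step
  l v))])
  (fun l => iter D (expect p q) (fun u => (B u)%:R) (step l v))).
- by move=> l; exact: measurable_evolve.
- exact: us_anti.
- move=> c' c's; apply: IH => //.
    by rewrite size_step size_map sizeD vD minnn.
  move=> x; rewrite mem_cat => /orP[/mem_anti -> //|/sD].
  by apply: le_trans; lia.
Qed.

Lemma outcome_unknown_prob t :
  P [set o | outcome (X^~ o) t (0, 0) = None] = (unknown_density p q t)%:E.
Proof.
have := @evolve_prob t (nseq t.+1 None) (fun u => u == [:: None]) [::] (fun=>
  Open).
rewrite size_nseq => /(_ erefl erefl) E.
have -> : unknown_density p q t = label_weight [::] (fun=> Open) *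
    iter t (expect p q) (fun u => (u == [:: None])%:R) (nseq t.+1 None).
  by rewrite /label_weight big_nil mul1r.
rewrite -E //; congr (P _); apply/seteqP; split => o /=.
  by move=> ot; split=> //; rewrite evolve_unknown ot.
by move=> [_]; rewrite evolve_unknown => /eqP[].
Qed.

Lemma draw_bigcap : [set o | draw (fun x => X x o)] =
  \bigcap_t [set o | outcome (X^~ o) t (0, 0) = None].
Proof.
apply/seteqP; split => o /=.
  by move=> /draw_outcome dr t _; exact: dr.
by move=> dr; apply/draw_outcome => t; exact: (dr t I).
Qed.

Lemma measurable_draw : measurable [set o | draw (fun x => X x o)].
Proof.
rewrite draw_bigcap; apply: bigcapT_measurable => t; exact: measurable_outcome.
Qed.

(** A draw implies that the game truncated at depth t is undecided, for every t. *)
Lemma draw_prob0 : unknown_density p q t @[t --> \oo] --> (0 : R) ->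
  P [set o | draw (fun x => X x o)] = 0%E.
Proof.
move=> density_cvg0; have mdr := measurable_draw.
have dr_le t : fine (P [set o | draw (fun x => X x o)]) <= unknown_density p q
  t.
  rewrite -lee_fin (fineK (fin_num_measure P _ mdr)) -outcome_unknown_prob.
  apply: le_measure; rewrite ?inE //; first exact: measurable_outcome.
  by move=> o; rewrite draw_bigcap; apply.
rewrite -(fineK (fin_num_measure P _ mdr)); congr (_%:E).
apply/eqP; rewrite eq_le fine_ge0 ?measure_ge0 // andbT.
by apply: cvgr_to_ge density_cvg0 _; apply: nearW.
Qed.

End random_game.

Theorem theorem1 (R : realType) (p q : R)
    (p_ge0 : 0 <= p) (p_lt1 : p < 1) (q_ge0 : 0 <= q) (q_lt1 : q < 1)
    (pq_le1 : p + q <= 1) (pq_gt0 : 0 < p \/ 0 < q) :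
  ergodic (pca p q) /\
  forall (d : measure_display) (Omega : measurableType d)
      (P : probability Omega R) (X : vertex -> Omega -> site),
    percolation_field p q P X ->
    measurable [set w | draw (fun x => X x w)] /\
    P [set w | draw (fun x => X x w)] = 0%E.
Proof.
split; first exact: pca_ergodic.
move=> d Omega P X X_field; split; first exact: measurable_draw X_field.
by apply: (draw_prob0 X_field); exact: unknown_density_cvg0.
Qed.
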